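(* Let $w$ be a word with $|w|=n$, $\mathrm{alph}(w)=\Sigma$ and $\Sigma=\{1,2,\ldots,\sigma\}$ (with $\sigma\le n$), and let $k\ge \iota(w)$ be an integer. The minimal number of letter insertions that must be applied to $w$ in order to obtain a $k$-universal word (with respect to $\Sigma$) can be computed in $O(nk)$ time if $k\le n$, and in $O(n^2+T(n,\sigma,k))$ time otherwise, where $T(n,\sigma,k)$ is the time needed to compute the number $(k-n)\sigma$.
   Context: Computational model: unit-cost word RAM with memory words of $\log n$ bits for inputs of size $n$; the input word is over an integer alphabet $\{1,\ldots,\sigma\}$ with $\sigma\le n$ and contains at least two distinct letters. For a word $w$, $\mathrm{alph}(w)$ is the set of letters occurring in $w$. A word $v=v_1\cdots v_\ell$ is a subsequence of $w$ if $w=x_1v_1x_2v_2\cdots x_\ell v_\ell x_{\ell+1}$ for some words $x_i$. A word $w$ is $k$-universal with respect to $\Sigma$ if every word of length $k$ over $\Sigma$ is a subsequence of $w$; the universality index $\iota(w)$ is the largest $k$ such that $w$ is $k$-universal (with respect to $\mathrm{alph}(w)$). An insertion inserts one letter of $\Sigma$ at some position of the word. *)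

(* Defs.v *)
From mathcomp Require Import all_boot.

Set Implicit Arguments.
Unset Strict Implicit.
Unset Printing Implicit Defensive.

(** * Words, universality, insertions *)

(** Letters are natural numbers; an alphabet is a predicate on them. *)
Definition universal (S : {pred nat}) (k : nat) (w : seq nat) : Prop :=
  forall v : seq nat, size v = k -> {subset v <= S} -> subseq v w.

Definition is_universality_index (w : seq nat) (i : nat) : Prop :=
  universal [in w] i w /\ forall j : nat, universal [in w] j w -> j <= i.

Definition letters (sigma : nat) : {pred nat} := [pred a | 1 <= a <= sigma].

Definition inserts (S : {pred nat}) (x y : seq nat) : Prop :=
  exists (u v : seq nat) (a : nat), [/\ a \in S, x = u ++ v & y = u ++ a :: v].

Fixpoint insertions (S : {pred nat}) (m : nat) (x y : seq nat) : Prop :=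
  if m is m'.+1 then exists2 z, inserts S x z & insertions S m' z y
  else x = y.

Definition min_insertions (S : {pred nat}) (k : nat) (w : seq nat) (d : nat) :
    Prop :=
  (exists2 y, insertions S d w y & universal S k y) /\
  (forall m y, insertions S m w y -> universal S k y -> d <= m).

(** * Positional notation *)

Definition ndigits (B v : nat) : nat :=
  if v == 0 then 0 else (trunc_log B v).+1.

(** Base-[B] digits, least significant first, without leading zeros. *)
Definition digits (B v : nat) : seq nat :=
  mkseq (fun i => v %/ B ^ i %% B) (ndigits B v).

(** * The unit-cost word RAM *)

(** A program uses finitely many registers, each holding one word, and
    finitely many memory banks, each consisting of one cell per word-sized
    address.  Register names, bank names and jump targets are literals of the
    program text; cell addresses are computed at run time. *)
Inductive binop :=
  | OpAdd | OpSub | OpMul | OpDiv | OpMod | OpAnd | OpOr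
  | OpXor | OpShl | OpShr | OpLt | OpEq.

Inductive instr :=
  | Const (rd c : nat)
  | Binop (o : binop) (rd ra rb : nat)
  | Read (rd b ra : nat)
  | Write (b ra rs : nat)
  | Jz (r l : nat)
  | Jmp (l : nat).

Definition program := seq instr.

Record config := Config {
  pc : nat;
  reg : nat -> nat;
  cell : nat -> nat -> nat   (* bank, then address *)
}.

Definition set_reg (f : nat -> nat) (r x : nat) : nat -> nat :=
  fun r' => if r' == r then x else f r'.

Definition set_cell (f : nat -> nat -> nat) (b a x : nat) : nat -> nat -> nat :=
  fun b' a' => if (b' == b) && (a' == a) then x else f b' a'.

(** Arithmetic on [W]-bit words, modulo [2 ^ W]; division by zero yields zero,
    and the remainder modulo zero is the first operand. *)
Definition eval_binop (W : nat) (o : binop) (x y : nat) : nat :=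
  match o with
  | OpAdd => x + y
  | OpSub => x + 2 ^ W - y
  | OpMul => x * y
  | OpDiv => x %/ y
  | OpMod => x %% y
  | OpAnd => Nat.land x y
  | OpOr  => Nat.lor x y
  | OpXor => Nat.lxor x y
  | OpShl => x * 2 ^ y
  | OpShr => x %/ 2 ^ y
  | OpLt  => x < y
  | OpEq  => x == y
  end %% 2 ^ W.

Definition exec (W : nat) (i : instr) (c : config) : config :=
  let: Config p f m := c in
  match i with
  | Const rd x => Config p.+1 (set_reg f rd (x %% 2 ^ W)) m
  | Binop o rd ra rb =>
      Config p.+1 (set_reg f rd (eval_binop W o (f ra) (f rb))) m
  | Read rd b ra => Config p.+1 (set_reg f rd (m b (f ra))) m
  | Write b ra rs => Config p.+1 f (set_cell m b (f ra) (f rs))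
  | Jz r l => Config (if f r == 0 then l else p.+1) f m
  | Jmp l => Config l f m
  end.

(** The machine halts when control leaves the program text; a halted
    configuration is stationary. *)
Definition halted (P : program) (c : config) : bool := size P <= pc c.

Definition step (W : nat) (P : program) (c : config) : config :=
  if onth P (pc c) is Some i then exec W i c else c.

(** Unlisted registers, banks and cells initially hold zero. *)
Definition init (args : seq nat) (banks : seq (seq nat)) : config :=
  Config 0 (nth 0 args) (fun b a => nth 0 (nth [::] banks b) a).

(** A possibly multi-word number is returned as its number of base-[2 ^ W]
    digits, in register 0, and the digits themselves, in bank 2. *)
Definition returns (W : nat) (c : config) (v : nat) : Prop :=
  reg c 0 = ndigits (2 ^ W) v /\
  forall i, i < ndigits (2 ^ W) v -> cell c 2 i = nth 0 (digits (2 ^ W) v) i.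

(** Since halted configurations are stationary, [t] is an upper bound on the
    number of executed instructions. *)
Definition computes_within (W : nat) (P : program) (args : seq nat)
    (banks : seq (seq nat)) (t v : nat) : Prop :=
  let c := iter t (step W P) (init args banks) in halted P c /\ returns W c v.

(** The word size is the bit length of the input size, where the input consists
    of the [n] letters of the word and the bits of [k].  It exceeds the bit
    length of [n] by at most one as long as [k < 2 ^ n]; for larger [k] the
    digits of [k] still have to be addressable. *)
Definition word_size (n k : nat) : nat := ndigits 2 (n + ndigits 2 k).

(** [k] is passed as its number of digits, in register 0, and its digits, in
    bank 0; [n] is in register 1, and [w] is in bank 1. *)
Definition computes_from_word (P : program) (w : seq nat) (k t v : nat) : Prop :=
  let n := size w in
  let W := word_size n k in
  computes_within W P [:: ndigits (2 ^ W) k; n] [:: digits (2 ^ W) k; w] t v.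

(** [T n sigma k] bounds the time in which the program [P] computes
    [(k - n) * sigma] from [n], [sigma], [k] on the machine used for a word of
    length [n] and the number [k]. *)
Definition computes_product_in (P : program) (T : nat -> nat -> nat -> nat) :
    Prop :=
  forall n sigma k : nat, 1 < sigma -> sigma <= n -> n < k ->
    let W := word_size n k in
    computes_within W P [:: ndigits (2 ^ W) k; n; sigma] [:: digits (2 ^ W) k]
      (T n sigma k) ((k - n) * sigma).

(* Main.v *)
(* Cutting a k-universal word into k arches shows that k sigma - F k n insertions
   are needed, where F t j is the largest total number of distinct letters in t
   consecutive factors covering the prefix of length j; completing the factors
   of an optimal cover shows that they suffice.

   The function F t is j minus the number of lost positions up to j, and the set
   of positions lost at level t + 1 is found by a greedy pass over the word:
   starting with the positions lost at level t as a pool, each q = 1, ..., n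
   removes from the pool the largest position that does not exceed the previous
   occurrence of its letter, and q is lost if there is one.  The pool is stored
   as one bit mask per block of about log n positions, and an empty block is
   merged with its left neighbour into an interval of blocks by renaming the
   smaller side.  A block is renamed at most log n times and there are n / log n
   blocks, so that a pass takes O(n) time.

   If k > n, no position is lost at level k, and the answer (k - n) sigma +
   n (sigma - 1) arises from the given product by adding a two-word number.  The
   carry runs over nonzero digits only, each of which took the given program a
   step to write. *)
Require Import Defs.
From mathcomp Require Import all_boot.
From mathcomp Require Import zify.

Set Implicit Arguments.
Unset Strict Implicit.
Unset Printing Implicit Defensive.

(** * Insertions and arch factorizations *)

(** The bound [T] is not assumed to reach the number of digits of [k] or of the product: cells start
    at zero, so zero digits need not be written. Hence for [k > n] the program must not scan these
    numbers. It decides [k <= n] from the digit count and at most one digit of [k], and it stops the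
    final addition as soon as nothing is pending.

    The greedy pass rests on the function that maps [h] to [F t h + distinct (factor w h q)]. Its
    maximum over [i <= h <= q] exceeds [F t q] by the number of pool positions after [i] and up to
    [q]. So the pool encodes all these maxima at once, and [i = 0] gives [F (t + 1) q].

    Both cases end in the same addition of a two-word number to a digit string; for [k <= n] the
    string is empty. *)

Lemma insertions_subseq S m x y :
  insertions S m x y -> subseq x y /\ size y = size x + m.
Proof.
elim: m x => [|m IH] x /=; first by move=> ->; rewrite addn0.
case=> z [u [v [a [_ -> ->]]]] /IH [sub ->]; rewrite !size_cat /= addnS; split.
  apply: subseq_trans sub; rewrite cat_subseq //; exact: subseq_cons.
by rewrite addnS.
Qed.

Lemma insertions_trans S m1 m2 x y z :
  insertions S m1 x y -> insertions S m2 y z -> insertions S (m1 + m2) x z.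
Proof.
elim: m1 x => [|m1 IH] x /=; first by move=> ->.
by case=> x' xx' x'y yz; exists x' => //; exact: IH yz.
Qed.

Lemma insertions_context S m u v x y :
  insertions S m x y -> insertions S m (u ++ x ++ v) (u ++ y ++ v).
Proof.
elim: m x => [|m IH] x /=; first by move=> ->.
case=> z [u' [v' [a [aS -> ->]]]] /IH zy; exists (u ++ (u' ++ a :: v') ++ v) => //.
by exists (u ++ u'), (v' ++ v), a; split=> //; rewrite !catA // -!catA.
Qed.

Lemma insertions_append S s x :
  {subset s <= S} -> insertions S (size s) x (x ++ s).
Proof.
elim: s x => [|a s IH] x sS /=; first by rewrite cats0.
exists (rcons x a); last first.
  rewrite -cat_rcons; apply: IH => b bs; apply: sS; exact: mem_behead.
exists x, [::], a; split; [exact/sS/mem_head | by rewrite cats0 | by rewrite cats1].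
Qed.

Lemma subseq_split (T : eqType) (u a b : seq T) :
  subseq u (a ++ b) ->
  exists u1 u2, [/\ u = u1 ++ u2, subseq u1 a & subseq u2 b].
Proof.
case/subseqP=> m; rewrite size_cat => sz ->.
exists (mask (take (size a) m) a), (mask (drop (size a) m) b).
rewrite -mask_cat ?cat_take_drop ?mask_subseq //.
by rewrite size_take sz; case: ltnP; lia.
Qed.

Lemma subseq_cons_drop (T : eqType) (c : T) v y :
  subseq (c :: v) y -> subseq v (drop (index c y).+1 y).
Proof.
elim: y => //= b y IH; rewrite [b == c]eq_sym.
case: eqVneq => [_ | neq sub]; [by rewrite drop0 | exact: IH].
Qed.

Lemma universal_mem S k y a : universal S k.+1 y -> a \in S -> a \in y.
Proof.
move=> uni aS; apply/(mem_subseq (uni (nseq k.+1 a) (size_nseq _ _) _)).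
  by move=> b; rewrite mem_nseq => /andP [_ /eqP ->].
by rewrite inE eqxx.
Qed.


(* The letter of the alphabet whose first occurrence comes last ends the first
   arch, so every word starting with it continues after that arch. *)
Lemma universal_arch sigma k y :
  0 < sigma -> universal (letters sigma) k.+1 y ->
  exists a b, [/\ y = a ++ b, {subset letters sigma <= a} &
                  universal (letters sigma) k b].
Proof.
move=> s0 uni.
have [c cS cmax] : exists2 c, c \in letters sigma &
    forall a, a \in letters sigma -> index a y <= index c y.
  pose i0 := Ordinal s0.
  case: (@arg_maxnP _ i0 xpredT (fun i : 'I_sigma => index i.+1 y)) => // i _ im.
  exists i.+1; first by rewrite inE /= ltn_ord.
  move=> [|a]; rewrite inE //= => ale; exact: (im (Ordinal ale)).
exists (take (index c y).+1 y), (drop (index c y).+1 y).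
rewrite cat_take_drop; split=> // [a aS | v sv vS].
  by rewrite in_take ?ltnS ?cmax // (universal_mem uni).
apply/subseq_cons_drop/uni; first by rewrite /= sv.
by move=> b; rewrite inE => /predU1P [-> | /vS].
Qed.

(** * The best cover of a prefix by consecutive factors *)

Definition distinct (s : seq nat) : nat := size (undup s).

Definition factor (w : seq nat) (i j : nat) : seq nat := drop i (take j w).

(** The value 0 at level 0 for every [j] lets the first factor start anywhere, which does not raise
    the maximum: extending it to the left loses no letter. Empty factors are allowed, so [t] may
    exceed [j]. *)
Fixpoint best (w : seq nat) (t j : nat) : nat :=
  if t is t'.+1
  then \max_(i < j.+1) (best w t' i + distinct (factor w i j))
  else 0.

Lemma best_ge w t i j :
  i <= j -> best w t i + distinct (factor w i j) <= best w t.+1 j.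
Proof.
move=> ij; have ij' : i < j.+1 by [].
exact: (leq_bigmax (F := fun i : 'I_j.+1 => _) (Ordinal ij')).
Qed.

Lemma best_attained w t j :
  exists2 i, i <= j & best w t.+1 j = best w t i + distinct (factor w i j).
Proof.
have [i _ eqi] : {i : 'I_j.+1 | true & best w t.+1 j =
    best w t i + distinct (factor w i j)}.
  by apply: eq_bigmax_cond; rewrite card_ord.
by exists i => //; rewrite -ltnS.
Qed.

Lemma factor_ge w i j : j <= i -> factor w i j = [::].
Proof.
by move=> ji; rewrite /factor drop_oversize // size_take; case: ltnP; lia.
Qed.

Lemma factor_rcons w i j : i <= j -> j < size w ->
  factor w i j.+1 = rcons (factor w i j) (nth 0 w j).
Proof.
move=> ij jw; rewrite /factor (take_nth 0) // drop_rcons //.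
by rewrite size_take jw.
Qed.

Lemma distinct_rcons s a : distinct (rcons s a) = distinct s + (a \notin s).
Proof.
have -> : distinct (rcons s a) = distinct (a :: s).
  apply/perm_size/uniq_perm; rewrite ?undup_uniq // => b.
  by rewrite !mem_undup mem_rcons.
by rewrite /distinct /=; case: (a \in s); rewrite ?addn0 ?addn1.
Qed.

Lemma best_mono w t i j : i <= j -> j <= size w -> best w t i <= best w t j.
Proof.
elim: t i j => // t IH i j ij jw; have [i' i'i ->] := best_attained w t i.
apply: leq_trans (best_ge w t (leq_trans i'i ij)).
rewrite leq_add2l; elim: j ij jw => [|j IHj]; first by rewrite leqn0 => /eqP ->.
rewrite leq_eqVlt ltnS => /predU1P [-> // | ij] jw.
apply: leq_trans (IHj ij (ltnW jw)) _.
rewrite factor_rcons ?distinct_rcons ?leq_addr //; lia.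
Qed.

Lemma distinct_letters sigma s : {subset s <= letters sigma} ->
  distinct s <= sigma.
Proof.
move=> sS; rewrite -[leqRHS](size_iota 1); apply: uniq_leq_size (undup_uniq _) _.
by move=> a; rewrite mem_undup => /sS; rewrite inE /= mem_iota.
Qed.

Lemma sub_factor w i j : {subset factor w i j <= w}.
Proof. by move=> a /mem_drop /mem_take. Qed.

Lemma best_le w t j sigma : {subset w <= letters sigma} -> best w t j <= t * sigma.
Proof.
move=> wS; elim: t j => // t IH j; have [i _ ->] := best_attained w t j.
rewrite mulSn addnC leq_add ?IH // distinct_letters // => a /sub_factor; exact: wS.
Qed.

(** Cutting the prefix into single letters gains every position, and no cover gains more than the
    length of the prefix. *)
Lemma best_small w t j : j <= size w -> j <= t -> best w t j = j.
Proof.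
have best_lej t' j' : j' <= size w -> best w t' j' <= j'.
  elim: t' j' => // t' IH j' jw; have [i ij ->] := best_attained w t' j'.
  have := size_undup (factor w i j'); rewrite size_drop size_takel //.
  have := IH i (leq_trans ij jw); rewrite /distinct; lia.
move=> jw jt; apply/eqP; rewrite eqn_leq best_lej //=.
elim: t j jw jt => [|t IH] [|j] // jw; rewrite ltnS => jt.
apply: leq_trans (best_ge w t (leqnSn j)).
by rewrite factor_rcons // factor_ge //= addn1 ltnS IH // ltnW.
Qed.

(** * Optimality of completed covers *)

Section Minimum.
Variables (sigma : nat) (w : seq nat).
Hypotheses (sigma_gt0 : 0 < sigma) (wS : {subset w <= letters sigma}).

Lemma complete_factor s : {subset s <= letters sigma} ->
  exists2 y, insertions (letters sigma) (sigma - distinct s) s y &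
             {subset letters sigma <= y}.
Proof.
move=> sS; pose miss := [seq a <- iota 1 sigma | a \notin s].
have szm : size miss = sigma - distinct s.
  have <- := size_iota 1 sigma; rewrite -(count_predC (mem s) (iota 1 sigma)).
  suff -> : distinct s = count (mem s) (iota 1 sigma) by rewrite addKn size_filter.
  rewrite -size_filter; apply/perm_size/uniq_perm.
  - exact: undup_uniq.
  - exact/filter_uniq/iota_uniq.
  - move=> a; rewrite mem_undup mem_filter /=.
    case: (boolP (a \in s)) => //= /sS; rewrite inE /= mem_iota add1n ltnS.
    by move=> ->.
exists (s ++ miss).
  rewrite -szm; apply: insertions_append => a.
  by rewrite mem_filter mem_iota add1n ltnS => /andP [].
move=> a; rewrite mem_cat mem_filter mem_iota add1n ltnS /= inE => ->.
by case: (a \in s).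
Qed.

Lemma best_insertions t j : j <= size w ->
  exists2 y, insertions (letters sigma) (t * sigma - best w t j) (take j w) y &
             universal (letters sigma) t y.
Proof.
elim: t j => [|t IH] j jw.
  exists (take j w) => //.
  by move=> v /size0nil -> _; rewrite sub0seq.
have [i ij ->] := best_attained w t j.
have [y1 ins1 uni1] := IH i (leq_trans ij jw).
have fS : {subset factor w i j <= letters sigma}.
  by move=> a /sub_factor; exact: wS.
have [y2 ins2 sub2] := complete_factor fS.
exists (y1 ++ y2); last first.
  move=> v szv vS; rewrite -(cat_take_drop t v) cat_subseq //.
    by apply: uni1 => [|a /mem_take /vS //]; rewrite size_takel // szv.
  have : size (drop t v) = 1 by rewrite size_drop szv subSnn.
  have vS' a : a \in drop t v -> a \in y2 by move/mem_drop/vS/sub2.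
  case: (drop t v) vS' => [|a [|]] //= vS' _.
  by rewrite sub1seq vS' // mem_head.
have -> : t.+1 * sigma - (best w t i + distinct (factor w i j)) =
          (t * sigma - best w t i) + (sigma - distinct (factor w i j)).
  have := best_le t i wS; have := distinct_letters fS; lia.
have -> : take j w = take i w ++ factor w i j.
  by rewrite /factor -[in LHS](cat_take_drop i (take j w)) take_takel.
apply: (@insertions_trans _ _ _ _ (y1 ++ factor w i j)).
  exact: (insertions_context [::] (factor w i j) ins1).
by have := insertions_context y1 [::] ins2; rewrite !cats0.
Qed.

(** Arches are peeled off [y] from the left, each absorbing a piece of [u]. [t0] counts the arches
    already spent and [x] is the prefix of [w] that they absorbed; letters of [u] left after the
    last arch only enlarge [y]. *)
Lemma universal_deficit t t0 (x u y : seq nat) : w = x ++ u -> subseq u y ->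
  universal (letters sigma) t y ->
  t * sigma + best w t0 (size x) + size u <= size y + best w (t0 + t) (size w).
Proof.
elim: t t0 x u y => [|t IH] t0 x u y wE uy uni.
  rewrite addn0 mul0n add0n addnC leq_add ?size_subseq // best_mono //.
  by rewrite wE size_cat leq_addr.
have [a [b [yE aS bU]]] := universal_arch sigma_gt0 uni.
have [u1 [u2 [uE u1a u2b]]] : exists u1 u2, [/\ u = u1 ++ u2, subseq u1 a & subseq u2 b].
  by apply: subseq_split; rewrite -yE.
have := IH t0.+1 (x ++ u1) u2 b; rewrite -catA -uE => /(_ wE u2b bU).
have := best_ge w t0 (leq_addr (size u1) (size x)).
have -> : factor w (size x) (size x + size u1) = u1.
  by rewrite /factor wE uE catA -size_cat take_size_cat // drop_size_cat.
have : sigma + size u1 <= size a + distinct u1.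
  (* Besides the subsequence [u1], the arch has an occurrence of each letter absent from [u1]. *)
  pose r := filter [predC u1] a.
  have : sigma <= size (undup u1 ++ r).
    rewrite -[leqLHS](size_iota 1); apply: uniq_leq_size (iota_uniq _ _) _.
    move=> c; rewrite mem_iota add1n ltnS mem_cat mem_undup mem_filter /= => /aS ->.
    by case: (c \in u1).
  have : size u1 + size r <= size a.
    rewrite -(count_predC (mem u1) a) size_filter leq_add2r -size_filter.
    by apply: size_subseq; rewrite subseq_filter u1a andbT; apply/allP.
  rewrite size_cat /distinct; lia.
rewrite size_cat yE uE !size_cat addSnnS mulSn; lia.
Qed.

Lemma min_insertions_best k :
  min_insertions (letters sigma) k w (k * sigma - best w k (size w)).
Proof.
split.
  by have := best_insertions k (leqnn (size w)); rewrite take_size.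
move=> m y /insertions_subseq [wy sy] uni.
have := @universal_deficit k 0 [::] w y erefl wy uni.
by rewrite /= add0n sy; lia.
Qed.

End Minimum.

(** * Computing the layers greedily *)

(* Positions of a word are counted from 1; 0 stands for "no position". *)
Definition last_pos (a : nat) (s : seq nat) : nat := size s - index a (rev s).

Definition prev (w : seq nat) (q : nat) : nat :=
  last_pos (nth 0 w q.-1) (take q.-1 w).

Lemma last_pos_rcons a s b :
  last_pos a (rcons s b) = if b == a then (size s).+1 else last_pos a s.
Proof. by rewrite /last_pos rev_rcons size_rcons /=; case: eqP. Qed.

Lemma last_pos_le a s : last_pos a s <= size s.
Proof. exact: leq_subr. Qed.

Lemma mem_drop_last_pos a s i : (a \in drop i s) = (i < last_pos a s).
Proof.
elim/last_ind: s => [|s b IH] //; rewrite last_pos_rcons.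
have [le | gt] := leqP i (size s).
  rewrite drop_rcons // mem_rcons inE eq_sym IH.
  by case: eqP => // _; rewrite ltnS le.
rewrite drop_oversize ?size_rcons // in_nil; apply/esym/negbTE; rewrite -leqNgt.
by case: eqP => // _; apply: leq_trans (last_pos_le _ _) (ltnW gt).
Qed.

Lemma prev_lt w q : 0 < q -> prev w q < q.
Proof.
case: q => // q _; rewrite ltnS; apply: leq_trans (last_pos_le _ _) _.
by rewrite size_take /=; case: ltnP => // /ltnW.
Qed.

(** The factor occupies the positions [i + 1] to [j], hence the comparison with [i] is not strict; a
    first occurrence has [prev] 0 and always counts. *)
Lemma distinct_factorS w i j : i <= j -> j < size w ->
  distinct (factor w i j.+1) = distinct (factor w i j) + (prev w j.+1 <= i).
Proof.
move=> ij jw; rewrite factor_rcons // distinct_rcons; congr (_ + nat_of_bool _).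
by rewrite mem_drop_last_pos -leqNgt.
Qed.

Fixpoint floor_in (u : nat -> bool) (p : nat) : nat :=
  if p is p'.+1 then if u p then p else floor_in u p' else 0.

Lemma floor_in_le u p : floor_in u p <= p.
Proof. by elim: p => //= p IH; case: ifP => // _; apply: leqW. Qed.

Lemma floor_in_mem u p : 0 < floor_in u p -> u (floor_in u p).
Proof. by elim: p => //= p IH; case: ifP. Qed.

Lemma floor_in_max u p z : floor_in u p < z -> z <= p -> ~~ u z.
Proof.
elim: p => //= [|p IH]; first by rewrite leqn0 => ? /eqP ?; lia.
case: ifP => [_ | up]; first by lia.
by move=> lt; rewrite leq_eqVlt => /predU1P [-> | /IH ->]; rewrite ?up.
Qed.

Lemma floor_in_eq (u : nat -> bool) p x : x <= p -> (0 < x -> u x) ->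
  (forall z, x < z -> z <= p -> ~~ u z) -> floor_in u p = x.
Proof.
move=> xp ux xmax; have [lt | gt | //] := ltngtP (floor_in u p) x.
  have /negP := floor_in_max lt xp; case; apply: ux; exact: leq_ltn_trans lt.
have /negP := xmax _ gt (floor_in_le _ _); case.
by apply: floor_in_mem; apply: leq_ltn_trans gt.
Qed.

(** All of [L] is present from the start, although at time [q] only positions up to [q] matter: a
    search at [q] stays below [q], so later positions are intact when their turn comes. A failed
    search yields 0 and removes no position from 1 on. *)
Fixpoint pool (w : seq nat) (L : nat -> bool) (q : nat) : nat -> bool :=
  if q is q'.+1
  then fun y => pool w L q' y && (y != floor_in (pool w L q') (prev w q))
  else L.

Definition layer (w : seq nat) (L : nat -> bool) (q : nat) : bool :=
  floor_in (pool w L q.-1) (prev w q) != 0.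

(* best w t j turns out to be the number of positions up to j that are not lost
   at level t. *)
Definition lost (w : seq nat) (t : nat) : nat -> bool := iter t (layer w) predT.

Definition cnt (u : nat -> bool) (i j : nat) : nat :=
  \sum_(i.+1 <= y < j.+1) u y.

Lemma cnt_ge u i j : j <= i -> cnt u i j = 0.
Proof. by move=> ji; rewrite /cnt big_geq. Qed.

Lemma cntS u i j : i <= j -> cnt u i j.+1 = cnt u i j + u j.+1.
Proof. by move=> ij; rewrite /cnt big_nat_recr. Qed.

Lemma cnt_cat u i p j : i <= p -> p <= j -> cnt u i j = cnt u i p + cnt u p j.
Proof. by move=> ip pj; rewrite /cnt (@big_cat_nat _ _ _ p.+1). Qed.

Lemma cnt_remove (u : nat -> bool) x i j : u x ->
  cnt (fun y => u y && (y != x)) i j + (i < x <= j) = cnt u i j.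
Proof.
move=> ux; have [ji | ij] := leqP j i; first by rewrite !cnt_ge //; lia.
elim: j ij => // j IH; rewrite ltnS leq_eqVlt => /predU1P [<- | ij].
  rewrite !cntS // !cnt_ge //; case: eqVneq => [E | ne] /=.
    by rewrite E ux andbF; lia.
  by rewrite andbT; have -> : (i < x <= i.+1) = false; lia.
have ij' := ltnW ij; rewrite !cntS //. rewrite -(IH ij); case: eqVneq => [E | ne] /=.
  by rewrite E ux andbF; lia.
by rewrite andbT; have -> : (i < x <= j.+1) = (i < x <= j); lia.
Qed.

Lemma cnt_eq0 (u : nat -> bool) i j : (forall z, i < z -> z <= j -> ~~ u z) -> cnt u i j = 0.
Proof.
move=> uN; rewrite /cnt big_nat big1 // => z /andP [iz zj].
by rewrite (negbTE (uN z iz _)).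
Qed.

Lemma cnt_gt0 (u : nat -> bool) i j x : u x -> i < x -> x <= j -> 0 < cnt u i j.
Proof.
by move=> ux ix xj; rewrite -(cnt_remove i j ux) ix xj addn1.
Qed.

Lemma pool_out w L q y : q < y -> pool w L q y = L y.
Proof.
elim: q => //= q IH qy; rewrite IH ?(ltnW qy) //.
have := floor_in_le (pool w L q) (prev w q.+1).
have := prev_lt w (ltn0Sn q); case: eqP; rewrite ?andbT //; lia.
Qed.

Lemma cnt_poolS w L q i : i <= q ->
  let x := floor_in (pool w L q) (prev w q.+1) in
  cnt (pool w L q.+1) i q.+1 + (i < x) = cnt (pool w L q) i q + L q.+1.
Proof.
move=> iq x; rewrite cntS // /= -/x pool_out //.
have xp : x <= prev w q.+1 by apply: floor_in_le.
have xq : x <= q by have := prev_lt w (ltn0Sn q); lia.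
have -> /= : q.+1 != x by lia.
rewrite andbT; have [x0 | x_gt0] := posnP x.
  rewrite x0 ltn0 addn0; congr (_ + _); rewrite /cnt big_nat [RHS]big_nat.
  by apply: eq_bigr => y /andP [iy _]; have -> : y != 0; [lia | rewrite andbT].
have ux : pool w L q x by apply: floor_in_mem.
have <- := cnt_remove i q ux; rewrite xq andbT; lia.
Qed.

(** Conservation: a lost [q] removes one earlier position from the pool, and any other [q] removes
    none. *)
Lemma cnt_pool_layer w L q :
  cnt (pool w L q) 0 q + cnt (layer w L) 0 q = cnt L 0 q.
Proof.
elim: q => [|q IH]; first by rewrite !cnt_ge.
have := cnt_poolS w L (leq0n q); rewrite /= !(cntS (layer _ _)) // (cntS L) //.
rewrite /layer -lt0n /=; rewrite -IH -/(layer w L); lia.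
Qed.

(* Appending the letter at q raises F h + distinct (factor w h j) by one exactly
   for h >= prev w q; the pool marks the steps of the suffix maxima of this
   quantity, one of which is levelled by the raise. *)
Lemma pool_gain w L (F : nat -> nat) j :
  (forall i, i <= size w -> F i + cnt L 0 i = i) -> j <= size w ->
  forall i, i <= j ->
    (forall h, i <= h <= j ->
       F h + distinct (factor w h j) <= F j + cnt (pool w L j) i j) /\
    (exists2 h, i <= h <= j &
       F h + distinct (factor w h j) = F j + cnt (pool w L j) i j).
Proof.
move=> FL; elim: j => [|j IH] jw i.
  rewrite leqn0 => /eqP ->; rewrite cnt_ge //; split=> [h | ].
    by rewrite leqn0 => /eqP ->; rewrite factor_ge.
  by exists 0 => //; rewrite factor_ge.
have end_case : (forall h, j.+1 <= h <= j.+1 ->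
       F h + distinct (factor w h j.+1) <= F j.+1 + cnt (pool w L j.+1) j.+1 j.+1) /\
    (exists2 h, j.+1 <= h <= j.+1 &
       F h + distinct (factor w h j.+1) = F j.+1 + cnt (pool w L j.+1) j.+1 j.+1).
  rewrite cnt_ge //; split=> [h | ].
    by rewrite -eqn_leq => /eqP <-; rewrite factor_ge.
  by exists j.+1; rewrite ?leqnn // factor_ge.
rewrite leq_eqVlt ltnS => /predU1P [-> // | ij].
have {}IH := IH (ltnW jw); have [up [h0 h0ij h0E]] := IH i ij.
set p := prev w j.+1; have pj : p <= j by rewrite -ltnS prev_lt.
have [up_p [h1 h1pj h1E]] := IH p pj.
have := cnt_poolS w L ij; rewrite /= -/p; set x := floor_in _ _ => cntE.
have xp : x <= p by apply: floor_in_le.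
(* Combined with [cntE], this shows that the bound rises by one from [j] to [j + 1] if [x <= i] and
   stays if [i < x]; the term [L j.+1] cancels. *)
have FS : F j.+1 + L j.+1 = (F j).+1.
  by have := FL _ jw; have := FL _ (ltnW jw); rewrite cntS //; lia.
have cnt_ip : i <= p -> cnt (pool w L j) i j = cnt (pool w L j) i p + cnt (pool w L j) p j.
  by move=> ip; rewrite -cnt_cat.
have cat_p := cnt_ip.
split=> [h /andP [ih] | ].
  rewrite leq_eqVlt => /predU1P [-> | ]; last rewrite ltnS => hj.
    rewrite factor_ge //= addn0; lia.
  rewrite distinct_factorS //; have := up h; rewrite ih hj => /(_ isT) uph.
  (* With [i < x] the bound stays, while the starts [h >= p] gain one. These had slack, because [x]
     is counted after [i] but not after [p]. *)
  have [ix | xi] := ltnP i x; last by lia.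
  have ip : i <= p by lia.
  have x0 : 0 < x by lia.
  have := cnt_gt0 (floor_in_mem x0) ix xp; have := cnt_ip ip.
  have [ph | hp] := leqP (prev w j.+1) h; last by lia.
  have := up_p h; rewrite hj ph => /(_ isT); lia.
(* For [i < x] the same slack forces the old maximizer [h0] to lie before [p], where it keeps its
   value. *)
have [ix | xi] := ltnP i x.
  have ip : i <= p by lia.
  have x0 : 0 < x by lia.
  have := cnt_gt0 (floor_in_mem x0) ix xp; have := cnt_ip ip => E1 E2.
  have [ph | hp] := leqP p h0.
    have := up_p h0; have /andP [_ ->] := h0ij; rewrite ph => /(_ isT); lia.
  exists h0; first lia.
  rewrite distinct_factorS //; last by lia.
  rewrite -/p leqNgt hp; lia.
have [pi | ip] := leqP p i.
  exists h0; first lia.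
  rewrite distinct_factorS //; last by lia.
  rewrite -/p (_ : p <= h0); lia.
(* No pool position lies between [i] and [p], so the old maximum is also attained at a start from
   [p] on, and that start gains one. *)
have E : cnt (pool w L j) i p = 0.
  by apply: cnt_eq0 => z iz zp; apply: (floor_in_max _ zp); lia.
have := cnt_ip (ltnW ip); exists h1; first lia.
rewrite distinct_factorS //; last by lia.
rewrite -/p (_ : p <= h1); lia.
Qed.

(** Adding a last factor to the previous level is what [pool_gain] measures at [i = 0], and
    conservation turns the pool count into a count of lost positions. At level 0 every position is
    lost. *)
Lemma best_lost w t j : j <= size w -> best w t j + cnt (lost w t) 0 j = j.
Proof.
elim: t j => [|t IH] j jw.
  rewrite add0n /cnt (eq_bigr (fun=> 1)) // sum_nat_const_nat; lia.
have [up [h hj hE]] := pool_gain IH jw (leq0n j).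
have -> : best w t.+1 j = best w t j + cnt (pool w (lost w t) j) 0 j.
  apply/eqP; rewrite eqn_leq; apply/andP; split.
    by have [i ij ->] := best_attained w t j; apply: up.
  by rewrite -hE; apply: best_ge.
by rewrite -addnA [lost w t.+1]/(layer w (lost w t)) cnt_pool_layer IH.
Qed.

(** * Structured programs for the word RAM *)

Inductive exp :=
  | Var (x : nat)
  | Num (c : nat)
  | Bin (o : binop) (a b : exp)
  | Cell (b : nat) (a : exp).

Definition state := ((nat -> nat) * (nat -> nat -> nat))%type.

Fixpoint eval (W : nat) (s : state) (e : exp) : nat :=
  match e with
  | Var x => s.1 x
  | Num c => c %% 2 ^ W
  | Bin o a b => eval_binop W o (eval W s a) (eval W s b)
  | Cell b a => s.2 b (eval W s a)
  end.

(* The variable x lives in register 2x; the odd registers are temporaries. *)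
Definition loc (d : nat) (e : exp) : nat := if e is Var x then x.*2 else d.*2.+1.

Fixpoint compile (d : nat) (e : exp) : program :=
  match e with
  | Var _ => [::]
  | Num c => [:: Const d.*2.+1 c]
  | Bin o a b =>
      compile d a ++ compile d.+1 b ++ [:: Binop o d.*2.+1 (loc d a) (loc d.+1 b)]
  | Cell b a => compile d a ++ [:: Read d.*2.+1 b (loc d a)]
  end.

Fixpoint cost (e : exp) : nat :=
  match e with
  | Var _ => 0
  | Num _ => 1
  | Bin _ a b => cost a + cost b + 1
  | Cell _ a => cost a + 1
  end.

(* Code depends on the address at which it is placed, because of its jumps. *)
Definition code := nat -> program.

Definition skip : code := fun _ => [::].

Definition seqc (c1 c2 : code) : code :=
  fun o => c1 o ++ c2 (o + size (c1 o)).

(** There is no move instruction: a value is copied as its bitwise disjunction with itself. *)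
Definition assign (x : nat) (e : exp) : code := fun _ =>
  rcons (compile 0 e) (Binop OpOr x.*2 (loc 0 e) (loc 0 e)).

Definition store (b : nat) (a e : exp) : code := fun _ =>
  compile 0 a ++ compile 1 e ++ [:: Write b (loc 0 a) (loc 1 e)].

Definition ifc (e : exp) (c1 c2 : code) : code := fun o =>
  let o1 := o + (cost e).+1 in
  let o2 := o1 + (size (c1 o1)).+1 in
  compile 0 e ++ Jz (loc 0 e) o2 :: c1 o1 ++
    Jmp (o2 + size (c2 o2)) :: c2 o2.

Definition while (e : exp) (c : code) : code := fun o =>
  let o1 := o + (cost e).+1 in
  compile 0 e ++ Jz (loc 0 e) (o1 + (size (c o1)).+1) :: rcons (c o1) (Jmp o).

Definition placed (A : program) (o : nat) (p : program) : Prop :=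
  forall i, i < size p -> onth A (o + i) = onth p i.

Definition agree (s : state) (f : nat -> nat) : Prop := forall x, f x.*2 = s.1 x.

(* Total correctness with time credits: started in s with T credits, the code
   reaches its end in a state s' with T' credits left such that Q s' T', every
   executed instruction using up one credit. *)
Definition runs (W : nat) (c : code) (s : state) (T : nat)
    (Q : state -> nat -> Prop) : Prop :=
  forall A o f, placed A o (c o) -> agree s f ->
  exists t f' s' T', [/\ t + T' <= T, agree s' f', Q s' T' &
    iter t (step W A) (Config o f s.2) = Config (o + size (c o)) f' s'.2].

Section Rules.
Variable W : nat.
Implicit Types (s : state) (T : nat) (Q : state -> nat -> Prop) (A p : program).

Lemma size_compile d e : size (compile d e) = cost e.
Proof.
by elim: e d => //= [o a IHa b IHb | b a IHa] d; rewrite !size_cat ?IHa ?IHb ?addnA.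
Qed.

Lemma placed_cat A o p1 p2 :
  placed A o (p1 ++ p2) -> placed A o p1 /\ placed A (o + size p1) p2.
Proof.
move=> pl; split=> i ip.
  by rewrite pl ?onth_cat ?ip // size_cat ltn_addr.
rewrite -addnA pl ?size_cat ?ltn_add2l // onth_cat ltnNge leq_addr /=.
by rewrite addKn.
Qed.

Lemma placed_cons A o i p :
  placed A o (i :: p) -> onth A o = Some i /\ placed A o.+1 p.
Proof.
move=> pl; split; first by rewrite -[o]addn0 pl.
by move=> j jp; rewrite addSnnS pl.
Qed.

Lemma iter_cat t1 t2 A c1 c2 c3 :
  iter t1 (step W A) c1 = c2 -> iter t2 (step W A) c2 = c3 ->
  iter (t1 + t2) (step W A) c1 = c3.
Proof. by move=> E1 E2; rewrite addnC iterD E1. Qed.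

Lemma step_at A o f m i : onth A o = Some i ->
  step W A (Config o f m) = exec W i (Config o f m).
Proof. by rewrite /step /= => ->. Qed.

Lemma agree_tmp s f d x : agree s f -> agree s (set_reg f d.*2.+1 x).
Proof. by move=> ag y; rewrite /set_reg; case: eqP => [|_]; [lia | apply: ag]. Qed.

Lemma agree_set s f x y : agree s f -> agree (set_reg s.1 x y, s.2) (set_reg f x.*2 y).
Proof.
by move=> ag z; rewrite /set_reg /= -(ag z) -!muln2 eqn_pmul2r.
Qed.

(** The third clause protects temporaries of depth below [d], so that the value of a left operand
    survives the evaluation of the right one, which works one level deeper. *)
Lemma compile_correct A o d e s f : placed A o (compile d e) -> agree s f ->
  exists f', [/\ agree s f', f' (loc d e) = eval W s e,
    forall d', d' < d -> f' d'.*2.+1 = f d'.*2.+1 &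
    iter (cost e) (step W A) (Config o f s.2) = Config (o + cost e) f' s.2].
Proof.
have tmp d1 d2 g y : d1 < d2 -> set_reg g d2.*2.+1 y d1.*2.+1 = g d1.*2.+1.
  by move=> lt; rewrite /set_reg; case: eqP => //; lia.
elim: e o d f => [x | c | op a IHa b IHb | b a IHa] o d f pl ag /=.
- by exists f; rewrite addn0 -ag.
- have [E _] := placed_cons pl.
  exists (set_reg f d.*2.+1 (c %% 2 ^ W)); split=> [|| d' lt|].
  + exact: agree_tmp.
  + by rewrite /set_reg eqxx.
  + exact: tmp.
  + by rewrite (step_at _ _ E) /= addn1.
- have [pla pl'] := placed_cat pl; have [plb pli] := placed_cat pl'.
  have [fa [aga Ea fra ia]] := IHa _ _ _ pla ag.
  rewrite size_compile in plb pli.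
  have [fb [agb Eb frb ib]] := IHb _ _ _ plb aga.
  rewrite size_compile in pli; have [E _] := placed_cons pli.
  have Ea' : fb (loc d a) = eval W s a.
    by case: (a) Ea => [x | c | ? ? ? | ? ?] /= <-; rewrite ?frb // agb aga.
  exists (set_reg fb d.*2.+1 (eval_binop W op (eval W s a) (eval W s b))).
  split=> [|| d' lt|].
  + exact: agree_tmp.
  + by rewrite /set_reg eqxx.
  + by rewrite tmp // frb ?fra // ltnW.
  + rewrite (iter_cat (iter_cat ia ib) (t2 := 1) erefl) /=.
    by rewrite (step_at _ _ E) /= Ea' Eb !addnA addn1.
- have [pla pli] := placed_cat pl; have [fa [aga Ea fra ia]] := IHa _ _ _ pla ag.
  rewrite size_compile in pli; have [E _] := placed_cons pli.
  exists (set_reg fa d.*2.+1 (s.2 b (eval W s a))); split=> [|| d' lt|].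
  + exact: agree_tmp.
  + by rewrite /set_reg eqxx.
  + by rewrite tmp // fra.
  + rewrite (iter_cat ia (t2 := 1) erefl) /=.
    by rewrite (step_at _ _ E) /= Ea addnA addn1.
Qed.

Lemma runs_weaken c s T Q Q' :
  runs W c s T Q -> (forall s' T', Q s' T' -> Q' s' T') -> runs W c s T Q'.
Proof.
move=> run QQ' A o f pl ag; have [t [f' [s' [T' [le ag' q E]]]]] := run A o f pl ag.
by exists t, f', s', T'; split=> //; apply: QQ'.
Qed.

Lemma runs_skip s T Q : Q s T -> runs W skip s T Q.
Proof. by move=> q A o f _ ag; exists 0, f, s, T; rewrite addn0. Qed.

Lemma runs_seq c1 c2 s T Q :
  runs W c1 s T (fun s' T' => runs W c2 s' T' Q) -> runs W (seqc c1 c2) s T Q.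
Proof.
move=> run A o f /placed_cat [pl1 pl2] ag.
have [t1 [f1 [s1 [T1 [le1 ag1 q1 E1]]]]] := run A o f pl1 ag.
have [t2 [f2 [s2 [T2 [le2 ag2 q2 E2]]]]] := q1 A _ f1 pl2 ag1.
exists (t1 + t2), f2, s2, T2; split=> //; first lia.
by rewrite (iter_cat E1 E2) /seqc size_cat addnA.
Qed.

Lemma runs_assign x e s T Q :
  cost e < T -> eval W s e < 2 ^ W ->
  Q (set_reg s.1 x (eval W s e), s.2) (T - (cost e).+1) ->
  runs W (assign x e) s T Q.
Proof.
move=> cT small q A o f; rewrite /assign -cats1 => /placed_cat [ple pli] ag.
have [f1 [ag1 E1 _ i1]] := compile_correct ple ag.
rewrite size_compile in pli; have [E _] := placed_cons pli.
exists (cost e + 1), (set_reg f1 x.*2 (eval W s e)).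
exists (set_reg s.1 x (eval W s e), s.2), (T - (cost e).+1).
split=> //; [lia | exact: agree_set |].
rewrite (iter_cat i1 (t2 := 1) erefl) /= (step_at _ _ E) /= E1 size_cat size_compile.
by rewrite addn1 addnS /eval_binop PeanoNat.Nat.lor_diag modn_small.
Qed.

Lemma runs_store b a e s T Q :
  cost a + cost e < T ->
  Q (s.1, set_cell s.2 b (eval W s a) (eval W s e)) (T - (cost a + cost e).+1) ->
  runs W (store b a e) s T Q.
Proof.
move=> cT q A o f /placed_cat [pla /placed_cat [ple pli]] ag.
have [f1 [ag1 E1 _ i1]] := compile_correct pla ag.
rewrite size_compile in ple pli.
have [f2 [ag2 E2 fr2 i2]] := compile_correct ple ag1.
rewrite size_compile in pli; have [E _] := placed_cons pli.
have E1' : f2 (loc 0 a) = eval W s a.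
  by case: (a) E1 => [x | c | ? ? ? | ? ?] /= <-; rewrite ?fr2 // ag2 ag1.
exists (cost a + cost e + 1), f2.
exists (s.1, set_cell s.2 b (eval W s a) (eval W s e)), (T - (cost a + cost e).+1).
split=> //; first lia.
rewrite (iter_cat (iter_cat i1 i2) (t2 := 1) erefl) /= (step_at _ _ E) /= E1' E2.
by rewrite !size_cat !size_compile /= !addnA addn1.
Qed.

Lemma runs_if e c1 c2 s T Q :
  cost e + 2 <= T ->
  (eval W s e != 0 -> runs W c1 s (T - (cost e + 2)) Q) ->
  (eval W s e = 0 -> runs W c2 s (T - (cost e + 2)) Q) ->
  runs W (ifc e c1 c2) s T Q.
Proof.
move=> cT run1 run2 A o f; rewrite /ifc.
set o1 := o + (cost e).+1; set o2 := o1 + (size (c1 o1)).+1.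
move=> /placed_cat [ple]; rewrite size_compile => /placed_cons [Ejz].
rewrite -addnS => /placed_cat [pl1 /placed_cons []]; rewrite -/o1 -addnS -/o2.
move=> Ejmp pl2 ag; have [f1 [ag1 E1 _ i1]] := compile_correct ple ag.
rewrite size_cat /= size_cat /= size_compile.
have i2 : step W A (Config (o + cost e) f1 s.2) =
          Config (if eval W s e == 0 then o2 else o1) f1 s.2.
  by rewrite (step_at _ _ Ejz) /= E1 -addnS.
have -> : o + (cost e + (size (c1 o1) + (size (c2 o2)).+1).+1) = o2 + size (c2 o2).
  by rewrite /o2 /o1; lia.
have [e0 | e1] := eqVneq (eval W s e) 0.
  have [t [f' [s' [T' [le ag' q E]]]]] := run2 e0 A o2 f1 pl2 ag1.
  exists (cost e + 1 + t), f', s', T'; split=> //; first lia.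
  apply: iter_cat E; apply: iter_cat i1 _; by rewrite /= i2 e0.
have [t [f' [s' [T' [le ag' q E]]]]] := run1 e1 A o1 f1 pl1 ag1.
exists (cost e + 1 + t + 1), f', s', T'; split=> //; first lia.
apply: (iter_cat (c2 := Config (o1 + size (c1 o1)) f' s'.2)).
  by apply: iter_cat E; apply: iter_cat i1 _; rewrite /= i2 (negbTE e1).
by rewrite /= (step_at _ _ Ejmp).
Qed.

(** The invariant must guarantee credits for the next test. Termination then comes for free: every
    round spends credits, and the induction is on [T]. *)
Lemma runs_while e c s T Q (I : state -> nat -> Prop) :
  I s T ->
  (forall s T, I s T ->
    [/\ cost e + 2 <= T,
        eval W s e != 0 -> runs W c s (T - (cost e + 2)) I &
        eval W s e = 0 -> Q s (T - (cost e + 2))]) ->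
  runs W (while e c) s T Q.
Proof.
move=> Is step_I A o f; rewrite /while; set o1 := o + (cost e).+1.
set o2 := o1 + (size (c o1)).+1.
move=> /placed_cat [ple]; rewrite size_compile => /placed_cons [Ejz].
rewrite -addnS -cats1 => /placed_cat [plc /placed_cons []]; rewrite -/o1.
move=> Ejmp _ ag; rewrite size_cat /= size_cat /= size_compile.
have -> : o + (cost e + (size (c o1) + 1).+1) = o2 by rewrite /o2 /o1; lia.
have [N] := ubnP T; elim: N s T f Is ag => // N IH s T f Is ag TN.
have [cT run_c q] := step_I s T Is.
have [f1 [ag1 E1 _ i1]] := compile_correct ple ag.
have i2 : iter (cost e + 1) (step W A) (Config o f s.2) =
          Config (if eval W s e == 0 then o2 else o1) f1 s.2.
  by apply: iter_cat i1 _; rewrite /= (step_at _ _ Ejz) /= E1 -addnS.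
have [e0 | e1] := eqVneq (eval W s e) 0.
  exists (cost e + 1), f1, s, (T - (cost e + 2)); split=> //; first lia.
    exact: q.
  by rewrite i2 e0.
have [t [f' [s' [T' [le ag' Is' E]]]]] := run_c e1 A o1 f1 plc ag1.
have TN' : T' < N by lia.
have [t2 [f2 [s2 [T2 [le2 ag2 q2 E2]]]]] := IH s' T' f' Is' ag' TN'.
exists (cost e + 1 + t + 1 + t2), f2, s2, T2; split=> //; first lia.
apply: iter_cat E2; apply: (iter_cat (c2 := Config (o1 + size (c o1)) f' s'.2)).
  by apply: iter_cat E; rewrite i2 (negbTE e1).
by rewrite /= (step_at _ _ Ejmp).
Qed.

End Rules.

(** * Word operations without overflow *)

Section Arithmetic.
Variable W : nat.
Implicit Types x y : nat.

Lemma eval_add x y : x + y < 2 ^ W -> eval_binop W OpAdd x y = x + y.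
Proof. exact: modn_small. Qed.

Lemma eval_sub x y : y <= x -> x < 2 ^ W -> eval_binop W OpSub x y = x - y.
Proof.
move=> yx xW; rewrite /eval_binop -addnBAC // modnDr modn_small //.
exact: leq_ltn_trans (leq_subr _ _) xW.
Qed.

Lemma eval_mul x y : x * y < 2 ^ W -> eval_binop W OpMul x y = x * y.
Proof. exact: modn_small. Qed.

Lemma eval_div x y : x < 2 ^ W -> eval_binop W OpDiv x y = x %/ y.
Proof. by move=> xW; apply/modn_small/(leq_ltn_trans _ xW)/leq_div. Qed.

Lemma eval_mod x y : x < 2 ^ W -> eval_binop W OpMod x y = x %% y.
Proof. by move=> xW; apply/modn_small/(leq_ltn_trans _ xW)/leq_mod. Qed.

Lemma eval_shl x y : x * 2 ^ y < 2 ^ W -> eval_binop W OpShl x y = x * 2 ^ y.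
Proof. exact: modn_small. Qed.

Lemma eval_bool (b : bool) : 0 < W -> b %% 2 ^ W = b.
Proof.
move=> W0; apply: modn_small; apply: (@leq_ltn_trans 1); first by case: b.
by rewrite -{1}(expn0 2) ltn_exp2l.
Qed.

Lemma eval_lt x y : 0 < W -> eval_binop W OpLt x y = (x < y).
Proof. exact: eval_bool. Qed.

Lemma eval_eq x y : 0 < W -> eval_binop W OpEq x y = (x == y).
Proof. exact: eval_bool. Qed.

Implicit Types (s : state) (T : nat) (Q : state -> nat -> Prop).

Lemma runs_set v x e s T Q :
  eval W s e = v -> v < 2 ^ W -> cost e < T ->
  Q (set_reg s.1 x v, s.2) (T - (cost e).+1) -> runs W (assign x e) s T Q.
Proof. by move=> <- vW cT q; apply: runs_assign. Qed.

Lemma runs_put av v b a e s T Q :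
  eval W s a = av -> eval W s e = v -> cost a + cost e < T ->
  Q (s.1, set_cell s.2 b av v) (T - (cost a + cost e).+1) ->
  runs W (store b a e) s T Q.
Proof. by move=> <- <- cT q; apply: runs_store. Qed.

Lemma runs_test (c : bool) e c1 c2 s T Q :
  (eval W s e != 0) = c -> cost e + 2 <= T ->
  (c -> runs W c1 s (T - (cost e + 2)) Q) ->
  (~~ c -> runs W c2 s (T - (cost e + 2)) Q) ->
  runs W (ifc e c1 c2) s T Q.
Proof.
move=> <- cT run1 run2; apply: runs_if => // e0.
by apply: run2; rewrite e0.
Qed.

End Arithmetic.

(** * Positional notation *)

Definition digit_sum (B m : nat) (f : nat -> nat) : nat := \sum_(j < m) f j * B ^ j.

Lemma digit_sumS B m f : digit_sum B m.+1 f = digit_sum B m f + f m * B ^ m.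
Proof. by rewrite /digit_sum big_ord_recr. Qed.

Lemma digit_sum_lt B m f : (forall j, j < m -> f j < B) -> digit_sum B m f < B ^ m.
Proof.
elim: m => [|m IH] fB; first by rewrite /digit_sum big_ord0 expn0.
have IHm := IH (fun j jm => fB j (ltnW jm)).
rewrite digit_sumS expnS; apply: leq_trans (leq_mul (fB m (ltnSn m)) (leqnn _)).
by rewrite mulSn -addSn leq_add2r.
Qed.

Lemma digit_sum_digit B m f i : 0 < B -> (forall j, j < m -> f j < B) -> i < m ->
  digit_sum B m f %/ B ^ i %% B = f i.
Proof.
move=> B0; elim: m i => // m IH i fB im; rewrite digit_sumS.
have fB' j : j < m -> f j < B by move=> jm; apply/fB/ltnW.
have [{}im | mi] := ltnP i m.
  have -> : B ^ m = B ^ (m - i.+1) * B * B ^ i.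
    by rewrite -mulnA -expnS -expnD subnK.
  rewrite !mulnA addnC divnMDl ?expn_gt0 ?B0 //.
  by rewrite -modnDml modnMl add0n IH.
have -> : i = m by lia.
rewrite addnC divnMDl ?expn_gt0 ?B0 // divn_small ?digit_sum_lt // addn0.
by rewrite modn_small ?fB.
Qed.

Lemma ndigits_gt B v m : 1 < B -> (m < ndigits B v) = (B ^ m <= v).
Proof.
move=> B1; rewrite /ndigits; have [-> | v0] := eqVneq v 0.
  by rewrite ltn0 leqNgt expn_gt0 ltnW.
rewrite ltnS; apply/idP/idP => [mB | Bm]; last exact: trunc_log_max.
apply: leq_trans (trunc_logP B1 _); rewrite ?lt0n //.
by apply: leq_pexp2l => //; apply: ltnW.
Qed.

Lemma lt_expn_ndigits B v : 1 < B -> v < B ^ ndigits B v.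
Proof. by move=> B1; rewrite ltnNge -ndigits_gt // ltnn. Qed.

Lemma ndigits_le B v m : 1 < B -> v < B ^ m -> ndigits B v <= m.
Proof. by move=> B1 vB; rewrite leqNgt ndigits_gt // -ltnNge. Qed.

Lemma nth_digits B v i : i < ndigits B v -> nth 0 (digits B v) i = v %/ B ^ i %% B.
Proof. exact: nth_mkseq. Qed.

Lemma digit_sum_digits B v : 1 < B ->
  digit_sum B (ndigits B v) (nth 0 (digits B v)) = v.
Proof.
move=> B1; have B0 : 0 < B by apply: ltnW.
have sum m : digit_sum B m (fun i => v %/ B ^ i %% B) + v %/ B ^ m * B ^ m = v.
  elim: m => [|m IH]; first by rewrite /digit_sum big_ord0 expn0 divn1 muln1.
  rewrite digit_sumS -addnA -[RHS]IH; congr (_ + _).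
  by rewrite [in RHS](divn_eq (v %/ B ^ m) B) -divnMA -expnSr mulnDl -mulnA -expnS addnC.
rewrite -[RHS](sum (ndigits B v)) (divn_small (lt_expn_ndigits v B1)) addn0.
by apply: eq_bigr => i _; rewrite nth_digits.
Qed.

Lemma digit_lt B v i : 0 < B -> nth 0 (digits B v) i < B.
Proof.
move=> B0; have [le | lt] := leqP (ndigits B v) i.
  by rewrite nth_default // size_mkseq.
by rewrite nth_digits // ltn_mod.
Qed.

Lemma top_digit B v : 1 < B -> 0 < ndigits B v ->
  nth 0 (digits B v) (ndigits B v).-1 != 0.
Proof.
move=> B1 nd0; have B0 : 0 < B by apply: ltnW.
have lt : (ndigits B v).-1 < ndigits B v by rewrite prednK.
rewrite nth_digits // modn_small ?ltn_divLR ?expn_gt0 ?B0 //; last first.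
  by rewrite -expnS prednK // lt_expn_ndigits.
by rewrite -lt0n divn_gt0 ?expn_gt0 ?B0 // -ndigits_gt.
Qed.

Lemma ndigits_digit_sum B m f : 1 < B -> (forall j, j < m -> f j < B) ->
  (0 < m -> f m.-1 != 0) -> ndigits B (digit_sum B m f) = m.
Proof.
move=> B1 fB top; apply/eqP; rewrite eqn_leq ndigits_le ?digit_sum_lt //=.
case: m fB top => // m _ /(_ isT) /= fm; rewrite ndigits_gt // digit_sumS.
by apply: leq_trans (leq_addl _ _); rewrite leq_pmull // lt0n.
Qed.

Lemma returns_digit_sum W c :
  0 < W -> (forall j, j < reg c 0 -> cell c 2 j < 2 ^ W) ->
  (0 < reg c 0 -> cell c 2 (reg c 0).-1 != 0) ->
  returns W c (digit_sum (2 ^ W) (reg c 0) (cell c 2)).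
Proof.
move=> W0 cB top; have B1 : 1 < 2 ^ W by rewrite -{1}(expn0 2) ltn_exp2l.
have nd := ndigits_digit_sum B1 cB top; split=> // i; rewrite nd => im.
by rewrite nth_digits ?nd // digit_sum_digit // ltnW.
Qed.

(** * Adding a two-word number to a multi-word number *)

Definition set_at (f : nat -> nat) (i x : nat) : nat -> nat :=
  fun j => if j == i then x else f j.

(** At most one [B] is lost by truncation, and exactly when the remainder falls below an addend; a
    program can thus detect the carry by a comparison. *)
Lemma add_carry B x y : x < B -> y < B ->
  x + y = (x + y) %% B + ((x + y) %% B < x) * B.
Proof.
move=> xB yB; have [lt | ge] := ltnP (x + y) B.
  by rewrite modn_small // ltnNge leq_addr addn0.
have -> : (x + y) %% B = x + y - B.
  by rewrite -[in LHS](subnK ge) modnDr modn_small; lia.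
have -> : x + y - B < x by lia.
by rewrite mul1n subnK.
Qed.

Lemma digit_sum_eq B m f g : (forall j, j < m -> f j = g j) ->
  digit_sum B m f = digit_sum B m g.
Proof. by move=> fg; apply: eq_bigr => j _; rewrite fg. Qed.

Lemma digit_sum_set B m f i x : i < m ->
  digit_sum B m (set_at f i x) + f i * B ^ i = digit_sum B m f + x * B ^ i.
Proof.
elim: m => // m IH; rewrite ltnS leq_eqVlt !digit_sumS => /predU1P [-> | im].
  rewrite /set_at eqxx (@digit_sum_eq _ _ _ f) 1?addnAC // => j jm.
  by rewrite ltn_eqF.
by rewrite addnAC IH // {1}/set_at gtn_eqF // addnAC.
Qed.

(* An addition in progress: the number a + a2 B remains to be added at position
   i to the m digits f.  The top digit may vanish only while a carry that will
   extend the number is pending. *)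
Definition adding (B v : nat) (f : nat -> nat) (m i a a2 : nat) : Prop :=
  [/\ digit_sum B m f + (a + a2 * B) * B ^ i = v, i <= m,
      forall j, j < m -> f j < B,
      0 < m -> f m.-1 == 0 -> i = m /\ 0 < a + a2 & a < B /\ a2.+1 < B].

(* A step decreases this: a carry only survives a nonzero digit. *)
Definition add_work (f : nat -> nat) (m i a a2 : nat) : nat :=
  \sum_(i <= j < m) (f j != 0) + 2 * (a2 != 0) + (a != 0).

(** A step adds [a] to digit [i], a fresh zero digit if [i = m], and makes [a2] plus the carry the
    next low word. A carry needs [d] and [a] nonzero and is paid for by digit [i] leaving the sum;
    [a2] weighs two since it returns as a low word of weight one. *)
Lemma adding_step B v f m i a a2 :
  let d := if i < m then f i else 0 in
  let x := (d + a) %% B in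
  let m' := if i < m then m else i.+1 in
  adding B v f m i a a2 -> 0 < a + a2 -> 1 < B ->
  adding B v (set_at f i x) m' i.+1 (a2 + (x < d)) 0 /\
  add_work (set_at f i x) m' i.+1 (a2 + (x < d)) 0 < add_work f m i a a2.
Proof.
move=> d x m' [sum im fB top [aB a2B]] a_gt0 B1.
have dB : d < B by rewrite /d; case: ifP => [/fB // | _]; apply: ltnW.
have xB : x < B by rewrite ltn_mod ltnW.
have dax : d + a = x + (x < d) * B by apply: add_carry.
have c1 : (x < d) <= 1 by case: (x < d).
have f'B j : j < m' -> set_at f i x j < B.
  rewrite /set_at /m'; case: eqVneq => // ne; case: (i < m) => [/fB // |].
  by rewrite ltnS leq_eqVlt (negbTE ne) => lt; apply: fB; apply: leq_trans im.
split; last first.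
  rewrite /add_work muln0 addn0.
  have -> : \sum_(i.+1 <= j < m') (set_at f i x j != 0) = \sum_(i.+1 <= j < m) (f j != 0).
    rewrite /m'; case: ltnP => mi; last by rewrite !big_geq // leqW.
    by apply: eq_big_nat => j /andP [ij _]; rewrite /set_at [j == i]gtn_eqF.
  have [im' | mi] := ltnP i m; last first.
    rewrite [in X in _ < X]big_geq // [in X in X < _]big_geq ?leqW //.
    have -> : (x < d) = false by rewrite /d ifF ?ltn0 // ltnNge mi.
    by case: (a) a_gt0 => [|?]; case: (a2) => [|?].
  rewrite [X in _ < X + _ + _]big_ltn //.
  have d0 : d = 0 -> (x < d) = false by move=> ->.
  have fd : f i = d by rewrite /d im'.
  have [E | ne] := eqVneq d 0.
    by rewrite fd E ltn0; case: (a) a_gt0 => [|?]; case: (a2) => [|?] //=; lia.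
  have a0 : a = 0 -> (x < d) = false.
    by move=> a0; rewrite /x a0 addn0 modn_small // ltnn.
  rewrite fd ne; have [E | na] := eqVneq a 0.
    by rewrite a0 //; case: (a2) a_gt0; rewrite E //=; lia.
  by case: (a2) => [|?] /=; case: (x < d) => /=; lia.
have sumE : digit_sum B m' (set_at f i x) + d * B ^ i = digit_sum B m f + x * B ^ i.
  rewrite /m' /d; case: ltnP => [im' | mi]; first exact: digit_sum_set.
  have -> : m = i by apply/eqP; rewrite eqn_leq mi im.
  rewrite mul0n addn0 digit_sumS {2}/set_at eqxx; congr (_ + _).
  by apply: digit_sum_eq => j ji; rewrite /set_at ltn_eqF.
split=> //.
- have dP : d * B ^ i + a * B ^ i = x * B ^ i + (x < d) * (B * B ^ i).
    by rewrite -mulnDl dax mulnDl mulnA.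
  rewrite mul0n addn0 -sum expnS !mulnDl -[a2 * B * _]mulnA; lia.
- by rewrite /m'; case: ifP.
(* A zero written on top leaves something pending. Inside the number the old top digit was nonzero
   by [top], so the sum wrapped around; beyond it [a] is 0 and [a2] is positive. *)
- rewrite /m' /set_at; case: (ltnP i m) => [im' m0 | mi _ /=].
    case: (eqVneq m.-1 i) => [mE | ne fm0].
      move=> /eqP x0; split; first by rewrite -mE prednK.
      have : 0 < d + a.
        rewrite lt0n addn_eq0 /d im'; apply/negP => /andP [fi _].
        by move: fi; rewrite -mE => /(top m0) [im2 _]; rewrite im2 ltnn in im'.
      by rewrite dax x0 add0n; case: (0 < d); rewrite ?addn0 //; lia.
    by have [E _] := top m0 fm0; rewrite E ltnn in im'.
  rewrite eqxx => /eqP x0; split=> //; rewrite addn0.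
  have d0 : d = 0 by rewrite /d ifF // ltnNge mi.
  move: x0 a_gt0; rewrite /x d0 add0n modn_small // => ->; lia.
- by split=> //; lia.
Qed.

Arguments set_reg f r x r' /.
Arguments set_cell f b a x b' a' /.

Declare Scope code_scope.
Delimit Scope code_scope with code.
Notation "c1 ;; c2" := (seqc c1 c2)
  (at level 65, right associativity, only parsing) : code_scope.
Notation "x ::= e" := (assign x e) (at level 60, only parsing) : code_scope.
Notation "e1 :+ e2" := (Bin OpAdd e1 e2) (at level 50, left associativity).
Notation "e1 :- e2" := (Bin OpSub e1 e2) (at level 50, left associativity).
Notation "e1 :< e2" := (Bin OpLt e1 e2) (at level 55, no associativity).

Definition same_off (xs : seq nat) (f g : nat -> nat) : Prop :=
  forall x, x \notin xs -> g x = f x.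

Lemma same_off_set xs f g x v : x \in xs -> same_off xs f g ->
  same_off xs f (set_reg g x v).
Proof. by move=> xxs fg y yxs /=; case: eqP yxs => [->|_ /fg //]; rewrite xxs. Qed.

Lemma same_off_trans xs f g h : same_off xs f g -> same_off xs g h -> same_off xs f h.
Proof. by move=> fg gh x xxs; rewrite gh ?fg. Qed.

(* Variables: 0 holds the number of digits of k, later of the result, 1 n,
   2 sigma, 3 k, 4 and 5 the low and high word of a summand, 9 and 10 two
   factors, 11 and 12 the block size b and 2 ^ b, 13 the layer, 14 the position
   q, 16 and 18 the block and the bit found for q, 25 the number of lost
   positions; the others below 30 are scratch.
   Banks: 1 holds the word, 2 the result, 3 lost positions, 4 previous
   occurrences, 5 last occurrences, 6 logarithms, 7 masks of blocks, 8 to 10 the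
   names of the intervals of blocks and the ends of the named intervals. *)
Definition add_code : code := (
  6 ::= Num 0;;
  while ((Num 0 :< Var 4) :+ (Num 0 :< Var 5)) (
    ifc (Var 6 :< Var 0)
      (7 ::= Cell 2 (Var 6))
      (7 ::= Num 0;; 0 ::= Var 6 :+ Num 1);;
    8 ::= Var 7 :+ Var 4;;
    store 2 (Var 6) (Var 8);;
    4 ::= Var 5 :+ (Var 8 :< Var 7);;
    5 ::= Num 0;;
    6 ::= Var 6 :+ Num 1))%code.

Section Add.
Variable W : nat.
Hypothesis W2 : 1 < W.
Let B := 2 ^ W.

Lemma word_gt3 : 3 < B.
Proof. by rewrite /B -[4]/(2 ^ 2) leq_exp2l. Qed.

Lemma num_small c : c < 4 -> c %% 2 ^ W = c.
Proof. by move=> c4; apply: modn_small; apply: leq_trans word_gt3. Qed.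

Lemma add_code_correct v s T :
  adding B v (s.2 2) (s.1 0) 0 (s.1 4) (s.1 5) -> ndigits B v < B ->
  let C := 30 * (add_work (s.2 2) (s.1 0) 0 (s.1 4) (s.1 5)) + 30 in
  C <= T ->
  runs W add_code s T (fun s' _ => adding B v (s'.2 2) (s'.1 0) (s'.1 6) 0 0).
Proof.
move=> addv vB C CT; have B3 := word_gt3; have W0 : 0 < W by apply: ltnW.
apply: runs_seq; apply: (@runs_set _ 0); rewrite //= ?mod0n //; first by lia.
  by rewrite /C in CT; lia.
apply: (@runs_while _ _ _ _ _ _ (fun s T =>
  adding B v (s.2 2) (s.1 0) (s.1 6) (s.1 4) (s.1 5) /\
  30 * (add_work (s.2 2) (s.1 0) (s.1 6) (s.1 4) (s.1 5)) + 20 <= T)).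
  by split=> //=; rewrite /C in CT; lia.
move=> {addv C CT T s} [r m] T /= []; set nd := r 0; set i := r 6.
set a := r 4; set a2 := r 5 => addv CT.
have [sum im fB top [aB a2B]] := addv.
rewrite mod0n !eval_lt // eval_add; last first.
  rewrite -/B; move: B3; lia.
split=> [|nz|]; first by lia.
  have a_gt0 : 0 < a + a2 by lia.
  have B1 : 1 < B by lia.
  have := adding_step addv a_gt0 B1 => /=; rewrite -/a -/a2 -/nd -/i.
  set d := if i < nd then _ else _; set x := (d + a) %% B.
  set m' := if i < nd then _ else _ => -[add' work'].
  have dB : d < B by rewrite /d; case: ifP => [/fB //|_]; lia.
  (* The index does not overflow: [v] is at least [B ^ i], by the pending summand if [i = nd] and by
     the nonzero top digit otherwise, so [i] is below the digit count of [v]. *)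
  have iB : i.+1 < B.
    apply: leq_ltn_trans vB; rewrite ndigits_gt // -sum.
    have [im' | mi] := ltnP i nd; last first.
      by apply: leq_trans (leq_addl _ _); rewrite leq_pmull //; lia.
    apply: leq_trans (leq_addr _ _); move: im' top; case: (nd) => // n im' top.
    rewrite digit_sumS; apply: leq_trans (leq_addl _ _).
    apply: (@leq_trans (B ^ n)); first by rewrite leq_pexp2l // ltnW.
    rewrite leq_pmull // lt0n; apply/negP => fn.
    by have [E _] := top isT fn; rewrite E ltnn in im'.
  apply: runs_seq; apply: (@runs_weaken _ _ _ _ (fun s1 T1 => exists2 r1,
    s1 = (r1, m) & ([/\ r1 7 = d, r1 0 = m', r1 4 = a, r1 5 = a2 & r1 6 = i] /\ T <= T1 + 16))).
    apply: (@runs_test _ (i < nd)) => //= [|| lt | /negbTE ge].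
    + by rewrite eval_lt //; case: (i < nd).
    + lia.
    + apply: (@runs_set _ d); [by rewrite /d lt | by [] | by rewrite /=; lia |].
      by eexists; [by [] | split=> /=; [rewrite /m' lt | lia]].
    + apply: runs_seq; apply: (@runs_set _ 0); rewrite //= ?mod0n //; try lia.
      apply: (@runs_set _ m'); [by rewrite /= /m' ge num_small // eval_add addn1 | by rewrite /m' ge | by rewrite /=; lia |].
      by eexists; [by [] | split=> /=; [rewrite /d /m' ge | lia]].
  move=> _ T1 [r1 -> [[r7 r0 r4 r5 r6] TT1]].
  apply: runs_seq; apply: (@runs_set _ x); rewrite /= ?r7 ?r4 //; try lia.
  apply: runs_seq; apply: (@runs_put _ i x); rewrite //=; first lia.
  have cB : a2 + (x < d) < B by lia.
  apply: runs_seq; apply: (@runs_set _ (a2 + (x < d))); rewrite /= ?r5 ?r7 ?eval_lt ?eval_add //; try lia.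
  apply: runs_seq; apply: (@runs_set _ 0); rewrite /= ?mod0n //; try lia.
  apply: (@runs_set _ i.+1); rewrite /= ?r6 ?num_small ?eval_add ?addn1 //; try lia.
  by rewrite r0; split=> //; move: work'; rewrite -[set_cell m 2 i x 2]/(set_at (m 2) i x); lia.
move=> a0; have [a00 a20] : a = 0 /\ a2 = 0 by lia.
by move: addv; rewrite a00 a20.
Qed.

(** Multiplication returns only the low word, so the two-word product is built by additions, whose
    carries accumulate in variable 5. *)
Definition repeated_add : code := (
  4 ::= Num 0;;
  5 ::= Num 0;;
  6 ::= Num 0;;
  while (Var 6 :< Var 9) (
    4 ::= Var 4 :+ Var 10;;
    ifc (Var 4 :< Var 10) (5 ::= Var 5 :+ Num 1) skip;;
    6 ::= Var 6 :+ Num 1))%code.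

Lemma repeated_add_correct n c s T :
  s.1 9 = n -> s.1 10 = c -> n < B -> c < B ->
  20 * n.+1 <= T ->
  runs W repeated_add s T (fun s' T' => [/\ s'.2 = s.2, same_off [:: 4; 5; 6] s.1 s'.1,
    s'.1 4 + s'.1 5 * B = n * c, s'.1 4 < B & T <= T' + 20 * n.+1]).
Proof.
move=> s9 s10 nB cB CT; have B3 := word_gt3; have W0 : 0 < W by apply: ltnW.
do 3![apply: runs_seq; apply: (@runs_set _ 0); rewrite //= ?mod0n //; try lia].
apply: (@runs_while _ _ _ _ _ _ (fun s' T' => [/\ s'.2 = s.2,
    same_off [:: 4; 5; 6] s.1 s'.1, s'.1 6 <= n,
    s'.1 4 + s'.1 5 * B = s'.1 6 * c /\ s'.1 4 < B &
    20 * (n - s'.1 6) + 10 <= T' /\ T <= T' + 20 * s'.1 6 + 10])).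
  by split=> //=; [do 3![apply: same_off_set => //] | split; lia | lia].
move=> [r m] T' [/= mE off]; set i := r 6; set lo := r 4; set hi := r 5.
move=> iN [val loB] [CT' TT'].
have r9 : r 9 = n by rewrite off.
have r10 : r 10 = c by rewrite off.
rewrite r9 eval_lt //.
split=> [|lt|ge]; first by lia.
  have {}lt : i < n by lia.
  set lo' := (lo + c) %% B; set cy : nat := lo' < c.
  have carry : lo + c = lo' + cy * B by rewrite /cy /lo' [lo + c]addnC; apply: add_carry.
  have val' : lo' + (hi + cy) * B = i.+1 * c by lia.
  have hiB : hi + cy < B.
    have B0 : 0 < B by lia.
    rewrite -(ltn_pmul2r B0).
    have : i.+1 * c <= n * c by rewrite leq_mul2r lt orbT.
    have : n * c <= n * B by rewrite leq_mul2l (ltnW cB) orbT.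
    have : n * B < B * B by rewrite ltn_pmul2r //; lia.
    lia.
  have lo'B : lo' < B by rewrite ltn_mod; lia.
  apply: runs_seq; apply: (@runs_set _ lo'); rewrite /= ?r10 //; try lia.
  apply: runs_seq; apply: (@runs_weaken _ _ _ _ (fun s1 T1 => exists2 r1,
    s1 = (r1, m) & ([/\ same_off [:: 4; 5; 6] s.1 r1, r1 4 = lo', r1 5 = hi + cy & r1 6 = i]
      /\ T' <= T1 + 12))).
    apply: (@runs_test _ (lo' < c)) => /= [|| lt' | /negbTE ge'].
    + by rewrite r10 eval_lt //; case: (_ < _).
    + lia.
    + have cy1 : cy = 1 by rewrite /cy lt'.
      apply: (@runs_set _ (hi + cy)); rewrite /= ?num_small ?cy1 ?eval_add //; try lia.
      eexists; first by []; split; last by rewrite /=; lia.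
      by split=> //; do 2![apply: same_off_set => //].
    + apply: runs_skip; eexists; first by []; split; last by rewrite /=; lia.
      by rewrite /cy ge' addn0; split=> //; apply: same_off_set.
  move=> _ T1 [r1 -> [[off1 r4 r5 r6] TT1]].
  apply: (@runs_set _ i.+1); rewrite /= ?r6 ?num_small ?eval_add ?addn1 //; try lia.
  by rewrite r4 r5; split=> //; [apply: same_off_set | lia].
have iE : i = n by lia.
by split=> //; [rewrite val iE | lia].
Qed.

End Add.

(** * Running a given program as a subroutine *)

(* Register r of the subroutine becomes variable r + 30.  Banks 0 and 2 carry
   its input and output and are kept, bank 1 must be avoided. *)
Definition sub_var (r : nat) : nat := r + 30.

Definition sub_bank (b : nat) : nat := if odd b then b.*2.+1 else b.

(** Every target beyond the text means halting, so targets are capped at the length: a halt then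
    leads to the instruction right after the copy. *)
Definition relocate (o len : nat) (i : instr) : instr :=
  let p r := (sub_var r).*2 in
  match i with
  | Const rd c => Const (p rd) c
  | Binop op rd ra rb => Binop op (p rd) (p ra) (p rb)
  | Read rd b ra => Read (p rd) (sub_bank b) (p ra)
  | Write b ra rs => Write (sub_bank b) (p ra) (p rs)
  | Jz r l => Jz (p r) (o + minn l len)
  | Jmp l => Jmp (o + minn l len)
  end.

Definition call (P : program) : code := fun o => map (relocate o (size P)) P.

Definition simulates (f : nat -> nat) (m : nat -> nat -> nat) (c : config) : Prop :=
  (forall r, f (sub_var r).*2 = reg c r) /\
  (forall b a, m (sub_bank b) a = cell c b a).

Lemma sub_bank_inj : injective sub_bank.
Proof.
move=> b1 b2; rewrite /sub_bank; case: ifP => o1; case: ifP => o2 E; try lia.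
Qed.

Lemma relocate_step W (P : program) o f m c i :
  simulates f m c -> pc c < size P ->
  exists f' m', [/\ exec W (relocate o (size P) i) (Config (o + pc c) f m) =
      Config (o + minn (pc (exec W i c)) (size P)) f' m',
    simulates f' m' (exec W i c) & forall x, x < 30 -> f' x.*2 = f x.*2].
Proof.
case: c => p fP mP [/= simr simb] lt.
have pcS : (o + p).+1 = o + minn p.+1 (size P) by lia.
have set_sim rd x : simulates (set_reg f (sub_var rd).*2 x) m (Config p.+1 (set_reg fP rd x) mP).
  split=> // r /=; rewrite -simr; congr (if _ then _ else _).
  by rewrite /sub_var; apply/eqP/eqP; lia.
have set_old rd v x : x < 30 -> set_reg f (sub_var rd).*2 v x.*2 = f x.*2.
  by move=> x30 /=; case: eqP => //; rewrite /sub_var; lia.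
case: i => [rd x | op rd ra rb | rd b ra | b ra rs | r l | l] /=.
- by eexists; eexists; split; [rewrite pcS | apply: set_sim | apply: set_old].
- rewrite !simr.
  by eexists; eexists; split; [rewrite pcS | apply: set_sim | apply: set_old].
- rewrite simr simb.
  by eexists; eexists; split; [rewrite pcS | apply: set_sim | apply: set_old].
- eexists; eexists; split; [by rewrite pcS | split=> //= b' a | by []].
  by rewrite !simr (inj_eq sub_bank_inj) simb.
- by eexists; eexists; split; [rewrite simr; case: ifP; rewrite ?pcS | split | ].
- by eexists; eexists; split; [ | split | ].
Qed.

Lemma step_halted W P c t : halted P c -> iter t (step W P) c = c.
Proof.
move=> hal; elim: t => //= t ->; rewrite /step.
by rewrite onth_default.
Qed.

(** [simulates] reads registers while [s.1] lists variables; halving the index makes variable [x]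
    appear in register [2x]. *)
Lemma runs_call W P s T c t :
  simulates (fun r => s.1 r./2) s.2 c -> pc c = 0 ->
  halted P (iter t (step W P) c) -> t <= T ->
  runs W (call P) s T (fun s' T' =>
    [/\ simulates (fun r => s'.1 r./2) s'.2 (iter t (step W P) c),
        forall x, x < 30 -> s'.1 x = s.1 x & T <= T' + t]).
Proof.
move=> sim pc0 hal tT A o f pl ag.
have simf : simulates f s.2 c.
  by case: sim => simr simb; split=> // r; rewrite ag -simr doubleK.
have {pl} pl p i : onth P p = Some i -> onth A (o + p) = Some (relocate o (size P) i).
  move=> E; have pP : p < size P by rewrite -onthTE E.
  by rewrite pl ?size_map // onth_map E.
suff [t' [f' [m' [t't simf' old E]]]] : exists t' f' m', [/\ t' <= t,
    simulates f' m' (iter t (step W P) c), forall x, x < 30 -> f' x.*2 = f x.*2 &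
    iter t' (step W A) (Config (o + minn (pc c) (size P)) f s.2) =
    Config (o + size P) f' m'].
  exists t', f', (fun x => f' x.*2, m'), (T - t'); rewrite pc0 min0n addn0 in E.
  split=> //; [lia | | by rewrite /call size_map].
  split=> //=; [| by move=> x x30; rewrite old | lia].
  by case: simf' => simr simb; split=> // r; rewrite -simr doubleK.
clear sim pc0 tT ag.
elim: t c f (s.2) simf hal => [|t IH] c f m sim hal.
  by exists 0, f, m; split=> //=; congr Config; move: hal; rewrite /halted /=; lia.
case halc: (halted P c).
  exists 0, f, m; rewrite (minn_idPr halc); split=> //.
  by rewrite step_halted.
have run : pc c < size P by rewrite ltnNge; apply/negbT.
have [i Ei] : exists i, onth P (pc c) = Some i.
  by have := onthTE P (pc c); rewrite run; case: onth => // i _; exists i.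
have [f1 [m1 [E1 sim1 old1]]] := @relocate_step W P o f m c i sim run.
have stepE : step W P c = exec W i c by rewrite /step Ei.
rewrite iterSr stepE in hal *.
have [t' [f' [m' [t't sim' old' E']]]] := IH _ f1 m1 sim1 hal.
exists t'.+1, f', m'; split=> //; first by move=> x x30; rewrite old' ?old1.
by rewrite iterSr (minn_idPl (ltnW run)) (step_at _ _ _ (pl _ _ Ei)) E1 E'.
Qed.

(** A step changes at most one cell. For the output bank, this bounds the nonzero digits that a
    carry can cross by the time of the given program. *)
Lemma cell_support W P c t b : (forall a, cell c b a = 0) ->
  exists2 s : seq nat, size s <= t &
    forall a, cell (iter t (step W P) c) b a != 0 -> a \in s.
Proof.
move=> c0; elim: t => [|t [s st sup]] /=; first by exists [::] => // a; rewrite c0.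
have weak (c' : config) : cell c' b =1 cell (iter t (step W P) c) b ->
    exists2 s : seq nat, size s <= t.+1 & forall a, cell c' b a != 0 -> a \in s.
  by move=> E; exists s => [|a]; [apply: leqW | rewrite E; apply: sup].
rewrite /step; case: (iter t _ c) sup weak => p f m /= sup weak.
case: (onth P p) => [i|]; last exact: weak.
case: i => [rd x | o rd ra rb | rd b' ra | b' ra rs | r l | l];
  try by apply: weak.
exists (f ra :: s) => //= a; rewrite inE; case: andP => [[_ ->] // | _ /sup ->].
by rewrite orbT.
Qed.

Lemma count_support (f : nat -> nat) i m (s : seq nat) :
  (forall a, f a != 0 -> a \in s) -> \sum_(i <= j < m) (f j != 0) <= size s.
Proof.
move=> sup; have -> : \sum_(i <= j < m) (f j != 0) =
    size [seq j <- index_iota i m | f j != 0].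
  rewrite size_filter -sum1_count [RHS]big_mkcond /=.
  by apply: eq_bigr => j _; case: (f j != 0).
apply: uniq_leq_size; first exact/filter_uniq/iota_uniq.
by move=> a; rewrite mem_filter => /andP [/sup].
Qed.

(** * Predecessor search with deletions *)

Lemma digit_sum_mod B m f r : 0 < B -> (forall j, j < m -> f j < B) -> r <= m ->
  digit_sum B m f %% B ^ r = digit_sum B r f.
Proof.
move=> B0; elim: m => [|m IH] fB; first by rewrite leqn0 => /eqP ->; rewrite modn1 /digit_sum big_ord0.
rewrite leq_eqVlt => /predU1P [-> | ]; first by rewrite modn_small ?digit_sum_lt.
rewrite ltnS => rm; rewrite digit_sumS -(subnK rm) expnD mulnA addnC modnMDl subnK //.
by apply: IH => // j jm; apply/fB/ltnW.
Qed.

(** Unlike for [floor_in], the position found must be in [u] even if it is 0; with 0 as a sentinel,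
    the search on masks has no failure case. *)
Definition is_floor (u : nat -> bool) (p x : nat) : Prop :=
  [/\ x <= p, u x & forall z, x < z -> z <= p -> ~~ u z].

Lemma bits_eq0 m (f : nat -> bool) :
  (digit_sum 2 m f == 0) = [forall r : 'I_m, ~~ f r].
Proof.
rewrite /digit_sum sum_nat_eq0; apply: eq_forallb => r /=.
by rewrite muln_eq0 expn_eq0 /= orbF eqb0.
Qed.

Lemma bits_floor m (f : nat -> bool) : digit_sum 2 m.+1 f != 0 ->
  is_floor f m (trunc_log 2 (digit_sum 2 m.+1 f)).
Proof.
have fB j : (f j : nat) < 2 by case: (f j).
elim: m => [|m IH].
  rewrite digit_sumS /digit_sum big_ord0 add0n expn0 muln1 => f0.
  have f0' : f 0 by case: (f 0) f0.
  by rewrite f0'; split=> // z; case: z.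
rewrite digit_sumS; case fm: (f m.+1); last first.
  rewrite addn0 => /IH [le fx max]; split=> // [|z xz]; first exact: leqW.
  by rewrite leq_eqVlt => /predU1P [-> | /max ->] //; rewrite fm.
move=> _; rewrite mul1n.
have -> : trunc_log 2 (digit_sum 2 m.+1 f + 2 ^ m.+1) = m.+1.
  apply: trunc_log_eq => //; rewrite leq_addl /= [in ltnRHS]expnS mul2n -addnn ltn_add2r.
  by apply: digit_sum_lt.
by split=> // z; lia.
Qed.

Section Blocks.
Variable b : nat.
Hypothesis b0 : 0 < b.

Definition mask (u : nat -> bool) (B : nat) : nat :=
  digit_sum 2 b (fun r => u (B * b + r)).

Lemma mask_lt u B : mask u B < 2 ^ b.
Proof. by apply: digit_sum_lt => j _; case: (u _). Qed.

Lemma mask_eq0 (u : nat -> bool) B z : mask u B = 0 -> z %/ b = B -> ~~ u z.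
Proof.
move/eqP; rewrite bits_eq0 => /forallP uN zB.
have := uN (Ordinal (ltn_pmod z b0)); rewrite /= -zB.
by rewrite -divn_eq.
Qed.

Lemma mask_neq0 (u : nat -> bool) z : u z -> mask u (z %/ b) != 0.
Proof. by move=> uz; apply/eqP => /mask_eq0 /(_ erefl); rewrite uz. Qed.

Lemma mask_prefix u B r : r < b ->
  mask u B %% 2 ^ r.+1 = digit_sum 2 r.+1 (fun r => u (B * b + r)).
Proof. by move=> rb; apply: digit_sum_mod => // j _; case: (u _). Qed.

(** The remainder modulo [2 ^ (p %% b).+1] erases the bits of the block that lie above [p], and the
    logarithm finds the highest bit left. *)
Lemma floor_same_block u p : let X := mask u (p %/ b) %% 2 ^ (p %% b).+1 in
  X != 0 -> is_floor u p (p %/ b * b + trunc_log 2 X).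
Proof.
rewrite /= mask_prefix ?ltn_pmod // => /bits_floor.
set x := trunc_log 2 _ => -[xr ux max].
split=> //; first by rewrite {2}(divn_eq p b) leq_add2l.
move=> z xz zp; have zE : z = p %/ b * b + (z - p %/ b * b) by lia.
rewrite zE; apply: max; first by lia.
by have := divn_eq p b; lia.
Qed.

Lemma floor_other_block u p B :
  mask u (p %/ b) %% 2 ^ (p %% b).+1 = 0 -> B < p %/ b -> mask u B != 0 ->
  (forall C, B < C -> C < p %/ b -> mask u C = 0) ->
  is_floor u p (B * b + trunc_log 2 (mask u B)).
Proof.
move=> X0 Bp MB0 Cmax.
have [] : is_floor (fun r => u (B * b + r)) b.-1 (trunc_log 2 (mask u B)).
  by move: MB0; rewrite /mask -{1 3}(prednK b0) => /bits_floor; rewrite prednK.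
set x := trunc_log 2 _ => xb ux max.
have Bb : B.+1 * b <= p %/ b * b by rewrite leq_mul2r Bp orbT.
have pE := divn_eq p b.
split=> // [|z xz zp]; first by lia.
have zB : B <= z %/ b by rewrite leq_divRL //; lia.
have zpb : z %/ b <= p %/ b by apply: leq_div2r.
have zE := divn_eq z b; have zr : z %% b < b by rewrite ltn_mod.
have [E | ne] := eqVneq (z %/ b) B.
  by rewrite zE E; apply: max; [rewrite E in zE|]; lia.
have [E | ne2] := eqVneq (z %/ b) (p %/ b); last first.
  by apply: (mask_eq0 _ erefl); apply: Cmax; lia.
move/eqP: X0; rewrite mask_prefix ?ltn_pmod // bits_eq0 => /forallP uN.
have zr' : z %% b < (p %% b).+1 by rewrite E in zE; lia.
by have := uN (Ordinal zr'); rewrite /= -E -zE.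
Qed.

Lemma mask_eq (u v : nat -> bool) B : (forall y, y %/ b = B -> u y = v y) -> mask u B = mask v B.
Proof.
move=> uv; apply: digit_sum_eq => r rb; rewrite uv //.
by rewrite divnMDl // divn_small // addn0.
Qed.

Lemma mask_set (u v : nat -> bool) x : v x -> ~~ u x -> (forall y, y != x -> u y = v y) ->
  mask v (x %/ b) = mask u (x %/ b) + 2 ^ (x %% b).
Proof.
move=> vx ux uv; rewrite /mask.
have xr : x %% b < b by rewrite ltn_mod.
have := digit_sum_set 2 (fun r => u (x %/ b * b + r)) 1 xr.
rewrite -divn_eq (negbTE ux) addn0 mul1n => <-.
apply: digit_sum_eq => r rb; rewrite /set_at; case: eqP => [-> | ne].
  by rewrite -divn_eq vx.
rewrite uv //; apply/eqP => E; apply: ne.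
by rewrite -E modnMDl modn_small.
Qed.

End Blocks.

(* Blocks are partitioned into intervals, each consisting of a nonempty block
   followed by empty ones; lab gives the name of the interval of a block. *)
Definition groups (nb : nat) (mk lab lo hi : nat -> nat) : Prop :=
  forall B, B <= nb ->
    [/\ lab B <= nb, lo (lab B) <= B <= hi (lab B), hi (lab B) <= nb, mk (lo (lab B)) != 0
      & forall C, lo (lab B) <= C <= hi (lab B) ->
          lab C = lab B /\ (lo (lab B) < C -> mk C = 0)].

Definition group_size (lab lo hi : nat -> nat) (B : nat) : nat :=
  (hi (lab B) - lo (lab B)).+1.

(** A renaming at least doubles the interval of a block. With [d] at least the logarithm of the
    number of blocks, the term of a block bounds the renamings it still faces. *)
Definition potential (d nb : nat) (lab lo hi : nat -> nat) : nat :=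
  \sum_(B < nb.+1) (d - trunc_log 2 (group_size lab lo hi B)).

(** The first block of an interval is its only nonempty one, so a lookup replaces a scan to the left
    over empty blocks. *)
Lemma groups_floor nb mk lab lo hi B : groups nb mk lab lo hi -> B <= nb ->
  [/\ lo (lab B) <= B, mk (lo (lab B)) != 0 &
      forall C, lo (lab B) < C -> C <= B -> mk C = 0].
Proof.
move=> grp Bnb; have [_ /andP [loB Bhi] _ mk0 inner] := grp B Bnb.
split=> // C loC CB; have [] := inner C; first by lia.
by move=> _; apply.
Qed.

Lemma groups_eq nb mk mk' lab lo hi :
  (forall B, (mk B == 0) = (mk' B == 0)) -> groups nb mk lab lo hi -> groups nb mk' lab lo hi.
Proof.
move=> E grp B /grp [labB loB hiB mk0 inner]; split; rewrite -?E //.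
move=> C /inner [labC mkC]; split=> // /mkC /eqP; rewrite E; exact: eqP.
Qed.

(** * Merging an emptied block into the interval on its left *)

Section Merge.
Variables (d nb X : nat) (mk mk' lab lo hi : nat -> nat).
Hypotheses (grp : groups nb mk lab lo hi) (X0 : 0 < X) (Xnb : X <= nb).
Hypotheses (mkX : mk X != 0) (mk'X : mk' X = 0) (mk'E : forall B, B != X -> mk' B = mk B).

Let g1 := lab X.-1.
Let g2 := lab X.

(** A nonempty block can only be the first of its interval. So [X] starts one, and the block before
    it ends one. *)
Lemma merge_bounds : [/\ lo g2 = X, hi g1 = X.-1, lo g1 < X, X <= hi g2 & hi g2 <= nb].
Proof.
have [_ /andP [lo2 hi2] hi2nb _ in2] := grp Xnb.
have [_ /andP [lo1 hi1] _ _ in1] := grp (leq_trans (leq_pred X) Xnb).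
have loX : lo g2 = X.
  apply/eqP; rewrite eqn_leq lo2 leqNgt; apply/negP => lt.
  have [_ /(_ lt) mkX0] := in2 X (introT andP (conj lo2 hi2)).
  by move: mkX; rewrite mkX0.
have hi1E : hi g1 = X.-1.
  apply/eqP; rewrite eqn_leq hi1 andbT leqNgt; apply/negP => lt.
  have Xin : lo (lab X.-1) <= X <= hi (lab X.-1) by move: lo1 lt; rewrite -/g1; lia.
  have [labE _] := in1 X Xin.
  by move: loX; rewrite /g2 labE; lia.
by split=> //; move: lo1; rewrite -/g1; lia.
Qed.

(** The right interval has [hi g2 - X + 1] blocks and the left one [X - lo g1]. The strict
    comparison thus says that the right one is not larger, and it is then the one to be renamed. *)
Variables (fr to new : nat).
Hypothesis side : [/\ fr = X, to = hi g2, new = g1 & hi g2 - X < X - lo g1] \/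
                  [/\ fr = lo g1, to = X.-1, new = g2 & X - lo g1 <= hi g2 - X].

Variables (lab' lo' hi' : nat -> nat).
Hypotheses (lab'E : forall C, C <= nb -> lab' C = if fr <= C <= to then new else lab C).
Hypotheses (lo'E : lo' =1 set_at lo new (lo g1)) (hi'E : hi' =1 set_at hi new (hi g2)).

Lemma merge_inside C : lo g1 <= C <= hi g2 -> lab' C = new.
Proof.
have [loX hiX lo1 hi2 hi2nb] := merge_bounds.
have [_ _ _ _ in2] := grp Xnb.
have [_ _ _ _ in1] := grp (leq_trans (leq_pred X) Xnb).
move=> Cin; rewrite lab'E; last by lia.
case: ifP => // Cout; have [CX | XC] := ltnP C X.
  have [|-> _] := in1 C; first by rewrite -/g1 hiX; lia.
  by case: side => -[E1 E2 E3 _] //; lia.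
have [|-> _] := in2 C; first by rewrite -/g2 loX; lia.
by case: side => -[E1 E2 E3 _] //; lia.
Qed.

Lemma merge_outside C : C <= nb -> ~~ (lo g1 <= C <= hi g2) ->
  [/\ lab' C = lab C, lab C != g1 & lab C != g2].
Proof.
have [loX hiX lo1 hi2 hi2nb] := merge_bounds.
move=> Cnb Cout; have [_ Cin _ _ _] := grp Cnb; split.
- rewrite lab'E // ifF //; by case: side => -[-> -> _ _]; lia.
- by apply/eqP => E; rewrite E in Cin; lia.
- by apply/eqP => E; rewrite E in Cin; lia.
Qed.

Lemma new_cases : new = g1 \/ new = g2.
Proof. by case: side => -[_ _ -> _]; [left | right]. Qed.

Lemma merge_groups : groups nb mk' lab' lo' hi'.
Proof.
have [loX hiX lo1 hi2 hi2nb] := merge_bounds.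
have [g2nb _ _ _ in2] := grp Xnb.
have [g1nb _ _ mk1 in1] := grp (leq_trans (leq_pred X) Xnb).
move=> B Bnb; case Bin: (lo g1 <= B <= hi g2).
  rewrite (merge_inside Bin) lo'E hi'E /set_at eqxx; split=> //.
  - by case: new_cases => ->.
  - by rewrite mk'E //; apply/eqP => E; lia.
  move=> C Cin; split; first exact: merge_inside.
  move=> loC; have [-> // | CX] := eqVneq C X; rewrite mk'E //.
  have [lt | gt] := ltnP C X.
    by have [|_ ->] := in1 C; rewrite -/g1 ?hiX //; lia.
  by have [|_ ->] := in2 C; rewrite -/g2 ?loX //; lia.
have [labE ne1 ne2] := merge_outside Bnb (negbT Bin).
have [labB loB hiB mkB inner] := grp Bnb.
have neN : lab B != new by case: new_cases => ->.
rewrite labE lo'E hi'E /set_at (negbTE neN); split=> //.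
  have [E | ne] := eqVneq (lo (lab B)) X; last by rewrite mk'E.
  by have [|E2 _] := inner X; [lia | rewrite /g2 E2 eqxx in ne2].
move=> C Cin; have [labC mkC] := inner C Cin.
have Cnb : C <= nb by lia.
have Cout : ~~ (lo g1 <= C <= hi g2).
  apply/negP => Cin2; have [lt | gt] := ltnP C X.
    by have [|E _] := in1 C; [rewrite -/g1 hiX; lia | rewrite -labC E eqxx in ne1].
  by have [|E _] := in2 C; [rewrite -/g2 loX; lia | rewrite -labC E eqxx in ne2].
have [labE' _ _] := merge_outside Cnb Cout; rewrite labE'; split=> // /mkC.
have [-> // | ne] := eqVneq C X; by rewrite mk'E.
Qed.

Lemma sum_interval fr' to' : fr' <= to' -> to' <= nb ->
  \sum_(C < nb.+1) (fr' <= C <= to') = to'.+1 - fr'.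
Proof.
move=> frto tonb.
rewrite -(big_mkord xpredT (fun C => nat_of_bool (fr' <= C <= to'))).
rewrite (@big_cat_nat _ _ _ to'.+1) //= [X in _ + X]big_nat [X in _ + X]big1 ?addn0; last first.
  by move=> C /andP [tC _]; rewrite [C <= to']leqNgt tC andbF.
rewrite (@big_cat_nat _ _ _ fr') //= ?leqW // big_nat big1 ?add0n; last first.
  by move=> C /andP [_ Cf]; rewrite leqNgt Cf.
rewrite big_nat (eq_bigr (fun=> 1)); last by move=> C /andP [-> Ct]; rewrite -ltnS Ct.
by rewrite -big_nat sum_nat_const_nat muln1.
Qed.

(* Blocks whose name changes find themselves in an interval of at least twice
   the size. *)
Lemma merge_potential : trunc_log 2 nb.+1 <= d ->
  potential d nb lab' lo' hi' + (to.+1 - fr) <= potential d nb lab lo hi.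
Proof.
have [loX hiX lo1 hi2 hi2nb] := merge_bounds.
have [_ _ _ _ in2] := grp Xnb.
have [_ _ _ _ in1] := grp (leq_trans (leq_pred X) Xnb).
move=> dnb; have [frto tonb] : fr <= to /\ to <= nb.
  by case: side => -[-> -> _ _]; lia.
rewrite -(sum_interval frto tonb) -big_split /=; apply: leq_sum => -[C /= Cnb] _.
rewrite ltnS in Cnb; case Cin: (lo g1 <= C <= hi g2); last first.
  have [labE ne1 ne2] := merge_outside Cnb (negbT Cin).
  have neN : lab C != new by case: new_cases => ->.
  rewrite /group_size labE lo'E hi'E /set_at (negbTE neN) -[leqRHS]addn0 leq_add2l.
  by case: side => -[-> -> _ _]; lia.
rewrite /group_size merge_inside // lo'E hi'E /set_at eqxx.
set s := (hi g2 - lo g1).+1.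
have sd : trunc_log 2 s <= d by apply: leq_trans dnb; apply: leq_trunc_log; lia.
have grow s' : s' <= s -> 0 < s' -> (s' + s' <= s \/ ~~ (fr <= C <= to)) ->
    d - trunc_log 2 s + (fr <= C <= to) <= d - trunc_log 2 s'.
  move=> s's s'0 [dbl | /negbTE ->]; last by rewrite addn0 leq_sub2l // leq_trunc_log.
  have : (trunc_log 2 s').+1 <= trunc_log 2 s.
    by rewrite -trunc_log2_double // -addnn leq_trunc_log.
  by case: (fr <= C <= to) => /=; lia.
have [CX | XC] := ltnP C X.
  have [|-> _] := in1 C; first by rewrite -/g1 hiX; lia.
  by rewrite -/g1 hiX; apply: grow => //; rewrite /s; case: side => -[E1 E2 _ E4]; rewrite ?E1 ?E2; lia.
have [|-> _] := in2 C; first by rewrite -/g2 loX; lia.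
by rewrite -/g2 loX; apply: grow => //; rewrite /s; case: side => -[E1 E2 _ E4]; rewrite ?E1 ?E2; lia.
Qed.

End Merge.

Lemma potential_le d nb lab lo hi : potential d nb lab lo hi <= nb.+1 * d.
Proof.
rewrite -[X in _ <= X * _]card_ord -sum_nat_const.
by apply: leq_sum => C _; apply: leq_subr.
Qed.

(** * Tables *)

Definition same_mem (xs : seq nat) (m m' : nat -> nat -> nat) : Prop :=
  forall b a, b \notin xs -> m' b a = m b a.

Lemma same_mem_set xs m m' b a v : b \in xs -> same_mem xs m m' ->
  same_mem xs m (set_cell m' b a v).
Proof.
move=> bxs mm' b' a' b'xs /=; case: andP => [[/eqP E] | _]; last exact: mm'.
by rewrite -E (negbTE b'xs) in bxs.
Qed.

Definition fill_code (b c : nat) : code := (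
  6 ::= Num 0;;
  while (Var 6 :< Var 1 :+ Num 1) (
    store b (Var 6) (Num c);;
    6 ::= Var 6 :+ Num 1))%code.

Definition prev_code : code := (
  6 ::= Num 0;;
  while (Var 6 :< Var 1) (
    7 ::= Cell 1 (Var 6);;
    6 ::= Var 6 :+ Num 1;;
    store 4 (Var 6) (Cell 5 (Var 7));;
    store 5 (Var 7) (Var 6)))%code.

(** The guard negates that half of [n] is below the current power, so the doubled power is at most
    [n] and does not overflow. *)
Definition log_code : code := (
  11 ::= Num 0;;
  12 ::= Num 1;;
  while (Bin OpEq (Bin OpDiv (Var 1) (Num 2) :< Var 12) (Num 0)) (
    11 ::= Var 11 :+ Num 1;;
    12 ::= Var 12 :+ Var 12))%code.

Definition log_table_code : code := (
  6 ::= Num 2;;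
  while (Var 6 :< Var 12) (
    store 6 (Var 6) (Cell 6 (Bin OpDiv (Var 6) (Num 2)) :+ Num 1);;
    6 ::= Var 6 :+ Num 1))%code.

Definition mask_code : code := (
  6 ::= Num 0;;
  while (Var 6 :< Var 1 :+ Num 1) (
    16 ::= Bin OpDiv (Var 6) (Var 11);;
    store 7 (Var 16)
      (Cell 7 (Var 16) :+ Bin OpShl (Cell 3 (Var 6)) (Bin OpMod (Var 6) (Var 11)));;
    6 ::= Var 6 :+ Num 1))%code.

(** An interval is initially named after its first block. Variable 24 keeps the name of the current
    interval: a nonempty block replaces it, an empty one extends the interval. *)
Definition group_code : code := (
  6 ::= Num 0;;
  while (Var 6 :< Bin OpDiv (Var 1) (Var 11) :+ Num 1) (
    ifc (Cell 7 (Var 6)) (24 ::= Var 6 :+ Num 0;; store 9 (Var 24) (Var 6)) skip;;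
    store 8 (Var 6) (Var 24);;
    store 10 (Var 24) (Var 6);;
    6 ::= Var 6 :+ Num 1))%code.

Section Tables.
Variables (W : nat) (w : seq nat).
Let n := size w.
Hypotheses (n2 : 1 < n) (nW : n.+1 < 2 ^ W).
Let b := trunc_log 2 n.

Lemma W_gt1 : 1 < W.
Proof.
have [//|W1] := ltnP 1 W; have : 2 ^ W <= 2 ^ 1 by rewrite leq_exp2l.
by rewrite expn1; lia.
Qed.

Lemma log_gt0 : 0 < b.
Proof. by rewrite trunc_log_gt0. Qed.

Lemma log_le : 2 ^ b <= n.
Proof. by apply: trunc_logP => //; apply: ltnW. Qed.

Lemma log_lt : n < 2 * 2 ^ b.
Proof. by rewrite -expnS; apply: trunc_log_ltn. Qed.

Lemma log_small : b < n.
Proof. by apply: leq_trans log_le; apply: ltn_expl. Qed.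

Lemma fill_correct bk c s T : s.1 1 = n -> c < 4 -> 20 * n.+2 <= T ->
  runs W (fill_code bk c) s T (fun s' T' =>
    [/\ same_off [:: 6] s.1 s'.1, same_mem [:: bk] s.2 s'.2,
        forall y, y <= n -> s'.2 bk y = c & T <= T' + 20 * n.+2]).
Proof.
move=> s1 c4 CT; have W1 := W_gt1; have W0 := ltnW W1.
apply: runs_seq; apply: (@runs_set _ 0); rewrite //= ?mod0n //; try lia.
apply: (@runs_while _ _ _ _ _ _ (fun s' T' => [/\ same_off [:: 6] s.1 s'.1,
    same_mem [:: bk] s.2 s'.2, s'.1 6 <= n.+1,
    forall y, y < s'.1 6 -> s'.2 bk y = c &
    20 * (n.+1 - s'.1 6) + 10 <= T' /\ T <= T' + 20 * s'.1 6 + 10])).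
  by split=> //=; [apply: same_off_set | lia].
move=> [r m] T' [/= off mem]; set i := r 6 => iN done [CT' TT'].
rewrite off // s1 eval_lt // num_small // eval_add ?addn1 //.
split=> [|lt|ge]; first by lia.
  have {}lt : i < n.+1 by lia.
  apply: runs_seq; apply: (@runs_put _ i c); rewrite //= ?num_small //; first by lia.
  apply: (@runs_set _ i.+1); rewrite //= ?num_small ?eval_add ?addn1 //; try lia.
  split=> //=; [exact: same_off_set | apply: same_mem_set => //; exact: mem_head | | lia].
  move=> y yi; rewrite eqxx /=; case: eqP => // ne; apply: done; lia.
have iE : i = n.+1 by lia.
by split=> // [y yn|]; [apply: done | ]; lia.
Qed.

Lemma prev_correct s T : s.1 1 = n -> {in w, forall a, a <= n} ->
  (forall i, i < n -> s.2 1 i = nth 0 w i) -> (forall a, s.2 5 a = 0) ->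
  20 * n.+1 <= T ->
  runs W prev_code s T (fun s' T' =>
    [/\ same_off [:: 6; 7] s.1 s'.1, same_mem [:: 4; 5] s.2 s'.2,
        forall q, 0 < q -> q <= n -> s'.2 4 q = prev w q & T <= T' + 20 * n.+1]).
Proof.
move=> s1 wn m1 m5 CT; have W1 := W_gt1; have W0 := ltnW W1.
apply: runs_seq; apply: (@runs_set _ 0); rewrite //= ?mod0n //; try lia.
apply: (@runs_while _ _ _ _ _ _ (fun s' T' => [/\ same_off [:: 6; 7] s.1 s'.1,
    same_mem [:: 4; 5] s.2 s'.2, s'.1 6 <= n /\ (forall a, s'.2 5 a = last_pos a (take (s'.1 6) w)),
    forall q, 0 < q -> q <= s'.1 6 -> s'.2 4 q = prev w q &
    20 * (n - s'.1 6) + 10 <= T' /\ T <= T' + 20 * s'.1 6 + 10])).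
  split=> //=; [exact: same_off_set | | by case | lia].
  by split=> // a; rewrite m5 take0.
move=> [r m] T' [/= off mem]; set i := r 6 => -[iN last] done [CT' TT'].
rewrite off // s1 eval_lt //.
split=> [|lt|ge]; first by lia.
  have {}lt : i < n by lia.
  set a := nth 0 w i.
  have mi : m 1 i = a by rewrite mem // m1.
  have an : a <= n by apply: wn; apply: mem_nth.
  apply: runs_seq; apply: (@runs_set _ a); rewrite //=; try lia.
  apply: runs_seq; apply: (@runs_set _ i.+1); rewrite //= ?num_small ?eval_add ?addn1 //; try lia.
  apply: runs_seq; apply: (@runs_put _ i.+1 (last_pos a (take i w))); rewrite //=; try lia.
  apply: (@runs_put _ a i.+1); rewrite //=; try lia.
  split=> //=.
  - by do 2![apply: same_off_set => //].
  - by do 2![apply: same_mem_set => //].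
  - split=> // a'; rewrite (take_nth 0) // last_pos_rcons size_takel ?(ltnW lt) //.
    by rewrite -/a eq_sym; case: eqP.
  - move=> q q0; rewrite leq_eqVlt ltnS; case: eqVneq => [-> _ | ne /= qi].
      by rewrite /prev /= -/a.
    exact: done.
  - lia.
have iE : i = n by lia.
by split=> // [q q0 qn|]; [apply: done | ]; lia.
Qed.

Lemma log_correct s T : s.1 1 = n -> 20 * n.+1 <= T ->
  runs W log_code s T (fun s' T' =>
    [/\ same_off [:: 11; 12] s.1 s'.1, s'.2 = s.2, s'.1 11 = b,
        s'.1 12 = 2 ^ b & T <= T' + 20 * n.+1]).
Proof.
move=> s1 CT; have W1 := W_gt1; have W0 := ltnW W1.
apply: runs_seq; apply: (@runs_set _ 0); rewrite //= ?mod0n //; try lia.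
apply: runs_seq; apply: (@runs_set _ 1); rewrite //= ?num_small //; try lia.
apply: (@runs_while _ _ _ _ _ _ (fun s' T' => [/\ same_off [:: 11; 12] s.1 s'.1,
    s'.2 = s.2, s'.1 12 = 2 ^ s'.1 11, s'.1 12 <= n &
    20 * (n - s'.1 11) + 15 <= T' /\ T <= T' + 20 * s'.1 11 + 5])).
  by split=> //=; [do 2![apply: same_off_set => //] | lia | lia].
move=> [r m] T' [/= off memE]; set i := r 11; set p := r 12 => pE pn [CT' TT'].
rewrite off // s1 num_small // eval_div; last by lia.
rewrite eval_lt // num_small // eval_eq //.
have ip : i < p by rewrite pE ltn_expl.
split=> [|lt|ge]; first by lia.
  have {}lt : p <= n %/ 2 by lia.
  have ppn : p + p <= n by lia.
  apply: runs_seq; apply: (@runs_set _ i.+1); rewrite //= ?num_small ?eval_add ?addn1 //; try lia.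
  apply: (@runs_set _ (p + p)); rewrite //= ?num_small ?eval_add ?addn1 //; try lia.
  by split=> //=; [do 2![apply: same_off_set => //] | rewrite expnS; lia | lia].
have iE : b = i by apply: trunc_log_eq => //; rewrite expnS -pE pn; lia.
by split=> //=; [rewrite iE | lia].
Qed.

Lemma log_table_correct s T : s.1 12 = 2 ^ b -> s.2 6 1 = 0 -> 20 * n.+1 <= T ->
  runs W log_table_code s T (fun s' T' =>
    [/\ same_off [:: 6] s.1 s'.1, same_mem [:: 6] s.2 s'.2,
        forall y, 0 < y -> y < 2 ^ b -> s'.2 6 y = trunc_log 2 y & T <= T' + 20 * n.+1]).
Proof.
move=> s12 m61 CT; have W1 := W_gt1; have W0 := ltnW W1.
have bn := log_le; have b0 := log_gt0.
have p1 : 2 <= 2 ^ b by rewrite -{1}(expn1 2) leq_exp2l.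
apply: runs_seq; apply: (@runs_set _ 2); rewrite //= ?num_small //; try lia.
apply: (@runs_while _ _ _ _ _ _ (fun s' T' => [/\ same_off [:: 6] s.1 s'.1,
    same_mem [:: 6] s.2 s'.2, 1 < s'.1 6 <= 2 ^ b,
    forall y, 0 < y -> y < s'.1 6 -> s'.2 6 y = trunc_log 2 y &
    20 * (2 ^ b - s'.1 6) + 10 <= T' /\ T <= T' + 20 * s'.1 6])).
  split=> //=; [exact: same_off_set | | lia].
  by case=> [|[|]] // _ _; rewrite m61 trunc_log1.
move=> [r m] T' [/= off mem]; set i := r 6 => /andP [i1 iN] done [CT' TT'].
rewrite off // s12 eval_lt //.
split=> [|lt|ge]; first by lia.
  have {}lt : i < 2 ^ b by lia.
  have mi : m 6 (i %/ 2) = trunc_log 2 (i %/ 2) by apply: done; lia.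
  have logi : trunc_log 2 i = (trunc_log 2 (i %/ 2)).+1 by rewrite divn2 trunc_log2S.
  have logb : trunc_log 2 i <= b by rewrite -[leqRHS](@trunc_expnK 2) // leq_trunc_log // ltnW.
  have bs := log_small.
  apply: runs_seq; apply: (@runs_put _ i (trunc_log 2 i)); rewrite //= ?num_small // ?eval_div ?mi ?eval_add ?addn1 //; try lia.
  apply: (@runs_set _ i.+1); rewrite //= ?num_small ?eval_add ?addn1 //; try lia.
  split=> //=; [exact: same_off_set | exact: same_mem_set | lia | | lia].
  by move=> y y0; rewrite ltnS leq_eqVlt; case: eqVneq => [-> // | _ /=]; apply: done.
have iE : i = 2 ^ b by lia.
by split=> // [y y0 yn|]; [apply: done | ]; lia.
Qed.

Lemma mask_add (u : nat -> bool) i B :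
  mask b (fun y => (y < i.+1) && u y) B =
  mask b (fun y => (y < i) && u y) B + (if B == i %/ b then u i * 2 ^ (i %% b) else 0).
Proof.
have keep y : y != i -> ((y < i.+1) && u y) = ((y < i) && u y).
  by move=> ne; congr (_ && _); rewrite ltnS leq_eqVlt (negbTE ne).
have [-> | ne] := eqVneq B (i %/ b); last first.
  rewrite addn0; apply: mask_eq; first exact: log_gt0.
  by move=> y yB; rewrite keep //; apply: contraNneq ne => <-; rewrite yB.
case ui: (u i); last first.
  rewrite addn0; apply: mask_eq; first exact: log_gt0.
  by move=> y _; have [-> | /keep //] := eqVneq y i; rewrite ui !andbF.
rewrite mul1n; apply: mask_set; rewrite ?ltnSn ?ltnn ?log_gt0 //.
by move=> y /keep ->.
Qed.

Lemma mask_correct (u : nat -> bool) (s : state) T : s.1 1 = n -> s.1 11 = b ->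
  (forall y, y <= n -> s.2 3 y = u y) -> (forall y, y <= n -> s.2 7 y = 0) ->
  20 * n.+2 <= T ->
  runs W mask_code s T (fun s' T' =>
    [/\ same_off [:: 6; 16] s.1 s'.1, same_mem [:: 7] s.2 s'.2,
        forall B, B <= n -> s'.2 7 B = mask b (fun y => (y <= n) && u y) B &
        T <= T' + 20 * n.+2]).
Proof.
move=> s1 s11 m3 m7 CT; have W1 := W_gt1; have W0 := ltnW W1.
have b0 := log_gt0; have bn := log_le.
apply: runs_seq; apply: (@runs_set _ 0); rewrite //= ?mod0n //; try lia.
apply: (@runs_while _ _ _ _ _ _ (fun s' T' => [/\ same_off [:: 6; 16] s.1 s'.1,
    same_mem [:: 7] s.2 s'.2, s'.1 6 <= n.+1,
    forall B, B <= n -> s'.2 7 B = mask b (fun y => (y < s'.1 6) && u y) B &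
    20 * (n.+1 - s'.1 6) + 10 <= T' /\ T <= T' + 20 * s'.1 6 + 10])).
  split=> //=; [exact: same_off_set | | lia].
  move=> B Bn; rewrite m7 //; apply/esym/eqP; rewrite bits_eq0.
  by apply/forallP => r.
move=> [r m] T' [/= off mem]; set i := r 6 => iN done [CT' TT'].
have r1 : r 1 = n by rewrite off.
have r11 : r 11 = b by rewrite off.
rewrite r1 eval_lt // num_small // eval_add ?addn1 //.
split=> [|lt|ge]; first by lia.
  have {}lt : i <= n by lia.
  set B := i %/ b; have Bi : B <= i by apply: leq_div.
  have add := mask_add u i B; rewrite eqxx in add.
  have small := mask_lt b (fun y => (y < i.+1) && u y) B.
  apply: runs_seq; apply: (@runs_set _ B); rewrite //= ?r11 ?eval_div //; try lia.
  apply: runs_seq; apply: (@runs_put _ B (mask b (fun y => (y < i.+1) && u y) B));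
    rewrite //=; try lia.
    rewrite r11 -/i (mem 3 i) // m3 // eval_mod; last by lia.
    rewrite eval_shl; last by lia.
    by rewrite done ?eval_add -?add //; lia.
  apply: (@runs_set _ i.+1); rewrite //= ?num_small ?eval_add ?addn1 //; try lia.
  split=> //=; [by do 2![apply: same_off_set => //] | exact: same_mem_set | | lia].
  move=> C Cn; case: (eqVneq C B) => [-> // | ne] /=.
  by rewrite mask_add -/B (negbTE ne) addn0 done.
have iE : i = n.+1 by lia.
split=> // [B Bn|]; last by lia.
by rewrite done // iE.
Qed.

Lemma groups_new mk lab lo hi i :
  i = 0 \/ groups i.-1 mk lab lo hi -> mk i != 0 ->
  groups i mk (set_at lab i i) (set_at lo i i) (set_at hi i i).
Proof.
move=> grp mki B; rewrite leq_eqVlt /set_at => /predU1P [-> | Bi].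
  by rewrite !eqxx; split=> // [|C]; [lia | rewrite -eqn_leq => /eqP <-; rewrite eqxx ltnn].
have [i0 | {}grp] := grp; first by lia.
have [|labB loB hiB mkB inner] := grp B; first lia.
rewrite [B == i]ltn_eqF // [lab B == i]ltn_eqF //; last by lia.
split=> // [||C Cin]; [lia | lia |].
by rewrite [C == i]ltn_eqF; [apply: inner | lia].
Qed.

Lemma groups_empty mk lab lo hi i :
  0 < i -> groups i.-1 mk lab lo hi -> hi (lab i.-1) = i.-1 -> mk i = 0 ->
  groups i mk (set_at lab i (lab i.-1)) lo (set_at hi (lab i.-1) i).
Proof.
move=> i0 grp hig mki; set g := lab i.-1.
have [//|gi log _ mkg ing] := grp i.-1.
have keyg B : B <= i -> (if B == i then g else lab B) = g ->
    [/\ g <= i, lo g <= B <= i, i <= i, mk (lo g) != 0 &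
      forall C, lo g <= C <= i -> set_at lab i g C = g /\ (lo g < C -> mk C = 0)].
  move=> Bi labB; split=> //.
  - by apply: leq_trans gi (leq_pred i).
  - rewrite Bi andbT; move: labB; case: eqP => [-> _ | ne labB].
      by rewrite -/g in log; lia.
    have [|_ loB _ _ _] := grp B; first lia.
    by rewrite -labB; lia.
  move=> C /andP [gC Ci]; rewrite /set_at; case: eqP => [-> // | ne].
  by apply: ing; rewrite hig -/g; lia.
move=> B Bi; have labE : set_at lab i g B = if B == i then g else lab B by [].
rewrite labE; have := keyg B Bi; set x := if B == i then g else lab B.
have [-> /(_ erefl) | ne _] := eqVneq x g; first by rewrite /set_at eqxx.
have Bi' : B != i by apply: contraNneq ne => E; rewrite /x E eqxx.
have {labE}xE : x = lab B by rewrite /x (negbTE Bi').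
have [|labB loB hiB mkB inner] := grp B; first lia.
rewrite xE in ne *; rewrite {1 2}/set_at (negbTE ne); split=> //; try lia.
move=> C; rewrite /set_at (negbTE ne) => Cin.
by rewrite [C == i]ltn_eqF; [apply: inner | lia].
Qed.

Lemma group_correct s T : s.1 1 = n -> s.1 11 = b -> s.2 7 0 != 0 ->
  30 * n.+2 <= T ->
  runs W group_code s T (fun s' T' =>
    [/\ same_off [:: 6; 24] s.1 s'.1, same_mem [:: 8; 9; 10] s.2 s'.2,
        groups (n %/ b) (s'.2 7) (s'.2 8) (s'.2 9) (s'.2 10) &
        T <= T' + 30 * n.+2]).
Proof.
move=> s1 s11 m70 CT; have W1 := W_gt1; have W0 := ltnW W1.
have nbn : n %/ b <= n by apply: leq_div.
apply: runs_seq; apply: (@runs_set _ 0); rewrite //= ?mod0n //; try lia.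
apply: (@runs_while _ _ _ _ _ _ (fun s' T' => [/\ same_off [:: 6; 24] s.1 s'.1,
    same_mem [:: 8; 9; 10] s.2 s'.2, s'.1 6 <= (n %/ b).+1,
    s'.1 6 = 0 \/ [/\ groups (s'.1 6).-1 (s'.2 7) (s'.2 8) (s'.2 9) (s'.2 10),
      s'.1 24 = s'.2 8 (s'.1 6).-1 & s'.2 10 (s'.1 24) = (s'.1 6).-1] &
    30 * ((n %/ b).+1 - s'.1 6) + 15 <= T' /\ T <= T' + 30 * s'.1 6 + 5])).
  by split=> //=; [exact: same_off_set | left | lia].
move=> [r m] T' [/= off mem]; set i := r 6 => iN inv [CT' TT'].
have r1 : r 1 = n by rewrite off.
have r11 : r 11 = b by rewrite off.
have num1 : 1 %% 2 ^ W = 1 by rewrite num_small.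
rewrite r1 r11 eval_div; last by lia.
rewrite num1 eval_add ?addn1; last by lia.
rewrite eval_lt //.
split=> [|lt|ge]; first by lia.
  have {}lt : i <= n %/ b by lia.
  apply: runs_seq; apply: (@runs_test _ (m 7 i != 0)) => //= [|mki | /negbNE /eqP mki]; first lia.
    apply: runs_seq; apply: (@runs_set _ i); rewrite /= ?mod0n ?eval_add ?addn0 //; try lia.
    apply: (@runs_put _ i i); rewrite //=; first lia.
    apply: runs_seq; apply: (@runs_put _ i i); rewrite //=; first lia.
    apply: runs_seq; apply: (@runs_put _ i i); rewrite //=; first lia.
    apply: (@runs_set _ i.+1); rewrite //= ?num1 ?eval_add ?addn1 //; try lia.
    split=> //=; [by do 2![apply: same_off_set => //] | by do 3![apply: same_mem_set => //] | | lia].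
    right; rewrite !eqxx; split=> //.
    by apply: groups_new mki; case: inv => [-> | []]; [left | right].
  (* Block 0 is nonempty, so an empty block has an interval on its left to join. *)
  have [i0 | [grp r24 hi24]] := inv.
    by move: m70; rewrite -(mem 7 0) // -[X in m 7 X]i0 mki.
  have i_gt0 : 0 < i.
    by rewrite lt0n; apply/eqP => i0; move: m70; rewrite -(mem 7 0) // -[X in m 7 X]i0 mki.
  have g_le : r 24 <= i.-1 by rewrite r24; have [] := grp i.-1 (leqnn _).
  apply: runs_skip.
  apply: runs_seq; apply: (@runs_put _ i (r 24)); rewrite //=; first lia.
  apply: runs_seq; apply: (@runs_put _ (r 24) i); rewrite //=; first lia.
  apply: (@runs_set _ i.+1); rewrite //= ?num1 ?eval_add ?addn1 //; try lia.
  split=> //=; [exact: same_off_set | by do 2![apply: same_mem_set => //] | | lia].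
  right; rewrite !eqxx; split=> //.
  have := groups_empty i_gt0 grp; rewrite -r24 => /(_ hi24 mki).
  exact.
have iE : i = (n %/ b).+1 by lia.
have [i0 | [grp _ _]] := inv; first by lia.
by split=> //; [rewrite iE in grp | lia].
Qed.

End Tables.

(** * One layer *)

Definition merge_code : code := (
  19 ::= Cell 8 (Var 16);;
  20 ::= Cell 8 (Var 16 :- Num 1);;
  21 ::= Cell 9 (Var 20);;
  22 ::= Cell 10 (Var 19);;
  ifc (Var 22 :- Var 16 :< Var 16 :- Var 21)
    (6 ::= Var 16 :+ Num 0;; 23 ::= Var 22 :+ Num 1;; 24 ::= Var 20 :+ Num 0)
    (6 ::= Var 21 :+ Num 0;; 23 ::= Var 16 :+ Num 0;; 24 ::= Var 19 :+ Num 0);;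
  while (Var 6 :< Var 23) (
    store 8 (Var 6) (Var 24);;
    6 ::= Var 6 :+ Num 1);;
  store 9 (Var 24) (Var 21);;
  store 10 (Var 24) (Var 22))%code.

(** Shifting 2 rather than 1 keeps the bit of the previous occurrence itself. If no bit is left, the
    interval of the preceding block supplies the nearest nonempty block. *)
Definition find_code : code := (
  15 ::= Cell 4 (Var 14);;
  16 ::= Bin OpDiv (Var 15) (Var 11);;
  17 ::= Bin OpMod (Cell 7 (Var 16)) (Bin OpShl (Num 2) (Bin OpMod (Var 15) (Var 11)));;
  ifc (Var 17) skip (
    16 ::= Cell 9 (Cell 8 (Var 16 :- Num 1));;
    17 ::= Cell 7 (Var 16));;
  18 ::= Cell 6 (Var 17))%code.

(** Block and bit are both 0 exactly for the sentinel, so their sum tests whether a genuine position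
    was found. *)
Definition match_code : code := (
  find_code;;
  ifc (Var 16 :+ Var 18) (
    store 3 (Var 14) (Num 1);;
    store 7 (Var 16) (Cell 7 (Var 16) :- Bin OpShl (Num 1) (Var 18));;
    ifc (Cell 7 (Var 16)) skip merge_code)
    (store 3 (Var 14) (Num 0)))%code.

Section Layer.
Variables (W : nat) (w : seq nat).
Let n := size w.
Hypotheses (n2 : 1 < n) (nW : n.+1 < 2 ^ W).
Let b := trunc_log 2 n.
Let nb := n %/ b.

Lemma blocks_le : nb <= n.
Proof. exact: leq_div. Qed.

Lemma relabel_correct fr to new (s : state) T :
  s.1 6 = fr -> s.1 23 = to.+1 -> s.1 24 = new -> fr <= to -> to.+1 < 2 ^ W ->
  10 * (to.+1 - fr) + 10 <= T ->
  runs W (while (Var 6 :< Var 23) (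
    seqc (store 8 (Var 6) (Var 24)) (assign 6 (Var 6 :+ Num 1)))) s T (fun s' T' =>
    [/\ same_off [:: 6] s.1 s'.1, same_mem [:: 8] s.2 s'.2,
      forall C, s'.2 8 C = if fr <= C <= to then new else s.2 8 C &
      T <= T' + 10 * (to.+1 - fr) + 10]).
Proof.
move=> s6 s23 s24 frto toW CT; have W1 := W_gt1 n2 nW; have W0 := ltnW W1.
apply: (@runs_while _ _ _ _ _ _ (fun s' T' => [/\ same_off [:: 6] s.1 s'.1,
    same_mem [:: 8] s.2 s'.2, fr <= s'.1 6 <= to.+1,
    forall C, s'.2 8 C = if fr <= C < s'.1 6 then new else s.2 8 C &
    10 * (to.+1 - s'.1 6) + 10 <= T' /\ T <= T' + 10 * (s'.1 6 - fr)])).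
  split=> //=; [by lia | | by rewrite s6; lia].
  by move=> C; rewrite s6 ifF //; lia.
move=> [r m] T' [/= off mem]; set i := r 6 => /andP [fri ito] done [CT' TT'].
have r23 : r 23 = to.+1 by rewrite off.
have r24 : r 24 = new by rewrite off.
rewrite r23 eval_lt //.
split=> [|lt|ge]; first by lia.
  have {}lt : i <= to by lia.
  apply: runs_seq; apply: (@runs_put _ i new); rewrite //=; first lia.
  apply: (@runs_set _ i.+1); rewrite //= ?(num_small W1) ?eval_add ?addn1 //; try lia.
  split=> //=; [exact: same_off_set | exact: same_mem_set | lia | | lia].
  move=> C; rewrite done ltnS; case: (eqVneq C i) => [-> | ne] /=.
    by rewrite fri leqnn.
  by rewrite [C <= i]leq_eqVlt (negbTE ne).
have iE : i = to.+1 by lia.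
by split=> //; [move=> C; rewrite done iE ltnS | lia].
Qed.

(** Renaming a block costs at most 10 credits and is matched by a unit drop of the potential; 60
    credits cover the rest. [mk] gives the masks before block [X] became empty. *)
Lemma merge_correct d X mk (s : state) T :
  s.1 16 = X -> groups nb mk (s.2 8) (s.2 9) (s.2 10) -> 0 < X -> X <= nb ->
  mk X != 0 -> s.2 7 X = 0 -> (forall B, B != X -> s.2 7 B = mk B) ->
  trunc_log 2 nb.+1 <= d -> 60 + 10 * potential d nb (s.2 8) (s.2 9) (s.2 10) <= T ->
  runs W merge_code s T (fun s' T' =>
    [/\ same_off [:: 6; 19; 20; 21; 22; 23; 24] s.1 s'.1, same_mem [:: 8; 9; 10] s.2 s'.2,
      groups nb (s'.2 7) (s'.2 8) (s'.2 9) (s'.2 10) &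
      T + 10 * potential d nb (s'.2 8) (s'.2 9) (s'.2 10) <=
      T' + 60 + 10 * potential d nb (s.2 8) (s.2 9) (s.2 10)]).
Proof.
move=> s16 grp X0 Xnb mkX mX mE dnb CT; have W1 := W_gt1 n2 nW; have W0 := ltnW W1.
have nbn := blocks_le; have num0 : 0 %% 2 ^ W = 0 := mod0n _.
have num1 : 1 %% 2 ^ W = 1 by rewrite (num_small W1).
have [loX hiX lo1 hi2 hi2nb] := merge_bounds grp X0 Xnb mkX mX.
set lab := s.2 8 in grp loX hiX lo1 hi2 hi2nb CT *.
set lo := s.2 9 in grp loX hiX lo1 hi2 hi2nb CT *.
set hi := s.2 10 in grp loX hiX lo1 hi2 hi2nb CT *.
have g2nb : lab X <= nb by have [] := grp X Xnb.
have g1nb : lab X.-1 <= nb by have [] := grp X.-1 (leq_trans (leq_pred X) Xnb).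
apply: runs_seq; apply: (@runs_set _ (lab X)); rewrite //= ?s16 //; try (rewrite -?subnDA; lia).
apply: runs_seq; apply: (@runs_set _ (lab X.-1)); rewrite //= ?s16 ?num1 ?eval_sub ?subn1 //; try (rewrite -?subnDA; lia).
apply: runs_seq; apply: (@runs_set _ (lo (lab X.-1))); rewrite //=; try (rewrite -?subnDA; lia).
apply: runs_seq; apply: (@runs_set _ (hi (lab X))); rewrite //=; try (rewrite -?subnDA; lia).
have [fr [to [new [side frto]]]] : exists fr to new,
    ([/\ fr = X, to = hi (lab X), new = lab X.-1 & hi (lab X) - X < X - lo (lab X.-1)] \/
     [/\ fr = lo (lab X.-1), to = X.-1, new = lab X & X - lo (lab X.-1) <= hi (lab X) - X]) /\
    fr <= to <= nb.
  have [lt | ge] := ltnP (hi (lab X) - X) (X - lo (lab X.-1)).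
    by exists X, (hi (lab X)), (lab X.-1); split; [left | lia].
  by exists (lo (lab X.-1)), X.-1, (lab X); split; [right | lia].
have pot lab' lo' hi' A1 A2 A3 := @merge_potential d nb X mk (s.2 7) lab lo hi grp X0 Xnb mkX mX
  fr to new side lab' lo' hi' A1 A2 A3 dnb.
have mg lab' lo' hi' A1 A2 A3 := @merge_groups nb X mk (s.2 7) lab lo hi grp X0 Xnb mkX mX mE
  fr to new side lab' lo' hi' A1 A2 A3.
(* The drop of the potential, evaluated for the merged tables before they are computed, shows that
   there are enough credits for the renaming loop. *)
have room : to.+1 - fr <= potential d nb lab lo hi.
  apply: leq_trans (pot _ _ _ (fun C _ => erefl) (fun _ => erefl) (fun _ => erefl)).
  exact: leq_addl.
apply: runs_seq; apply: (@runs_weaken _ _ _ _ (fun s1 T1 => exists2 r1,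
    s1 = (r1, s.2) & [/\ same_off [:: 6; 19; 20; 21; 22; 23; 24] s.1 r1, r1 6 = fr,
      r1 23 = to.+1, r1 24 = new & [/\ r1 21 = lo (lab X.-1), r1 22 = hi (lab X) & T <= T1 + 40]])).
  apply: (@runs_test _ (hi (lab X) - X < X - lo (lab X.-1))) => [||lt|]; rewrite /= ?s16 //; try (rewrite -?subnDA; lia).
  - rewrite !eval_sub; try (rewrite -?subnDA; lia).
    by rewrite eval_lt //; case: (_ < _).
  - case: side => -[E1 E2 E3 E4]; last by lia.
    apply: runs_seq; apply: (@runs_set _ fr); rewrite //= ?s16 ?num0 ?eval_add ?addn0 //; try (rewrite -?subnDA; lia).
    apply: runs_seq; apply: (@runs_set _ to.+1); rewrite //= ?num1 ?eval_add ?addn1 ?E2 //; try (rewrite -?subnDA; lia).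
    apply: (@runs_set _ new); rewrite //= ?num0 ?eval_add ?addn0 ?E3 //; try (rewrite -?subnDA; lia).
    eexists; first by []; split=> //=; [by do 7![apply: same_off_set => //] | by split=> //; rewrite -?subnDA; lia].
  - move=> ge; case: side => -[E1 E2 E3 E4]; first by lia.
    apply: runs_seq; apply: (@runs_set _ fr); rewrite //= ?s16 ?num0 ?eval_add ?addn0 //; try (rewrite -?subnDA; lia).
    apply: runs_seq; apply: (@runs_set _ to.+1); rewrite //= ?s16 ?num0 ?eval_add ?addn0 ?E2 //; try (rewrite -?subnDA; lia).
    apply: (@runs_set _ new); rewrite //= ?num0 ?eval_add ?addn0 ?E3 //; try (rewrite -?subnDA; lia).
    eexists; first by []; split=> //=; [by do 7![apply: same_off_set => //] | by split=> //; rewrite -?subnDA; lia].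
move=> _ T1 [r1 -> [off1 r6 r23 r24 [r21 r22 TT1]]].
have toW : to.+1 < 2 ^ W by lia.
have frto' : fr <= to by lia.
apply: runs_seq; apply: runs_weaken (relabel_correct (s := (r1, s.2)) r6 r23 r24 frto' toW _) _; first by rewrite -?subnDA; lia.
move=> [r2 m2] T2 [/= off2 mem2 lab2 TT2].
have r2_24 : r2 24 = new by rewrite off2.
have r2_21 : r2 21 = lo (lab X.-1) by rewrite off2.
have r2_22 : r2 22 = hi (lab X) by rewrite off2.
apply: runs_seq; apply: (@runs_put _ new (lo (lab X.-1))); rewrite //=; first by rewrite -?subnDA; lia.
apply: (@runs_put _ new (hi (lab X))); rewrite //=; first by rewrite -?subnDA; lia.
have lo'E : set_cell (set_cell m2 9 new (lo (lab X.-1))) 10 new (hi (lab X)) 9 =1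
    set_at lo new (lo (lab X.-1)).
  by move=> C /=; rewrite /set_at; case: eqP => // _; rewrite mem2.
have hi'E : set_cell (set_cell m2 9 new (lo (lab X.-1))) 10 new (hi (lab X)) 10 =1
    set_at hi new (hi (lab X)).
  by move=> C /=; rewrite /set_at; case: eqP => // _; rewrite mem2.
split=> //.
- by move=> x xN; rewrite off2 ?off1 //; apply: contra xN; rewrite !inE => ->.
- do 2![apply: same_mem_set => //].
  by move=> B a; rewrite !inE !negb_or => /andP [B8 _]; rewrite mem2 // inE.
- have := mg _ _ _ (fun C _ => lab2 C) lo'E hi'E.
  have E B : (s.2 7 B == 0) = (m2 7 B == 0) by rewrite mem2.
  exact: (groups_eq E).
have := pot _ _ _ (fun C _ => lab2 C) lo'E hi'E.
rewrite -[set_cell _ _ _ _ 8]/(m2 8); lia.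
Qed.

(* Position 0 is never removed, so that every search succeeds. *)
Definition sentinel_pool (L : nat -> bool) (q y : nat) : bool :=
  (y == 0) || ((y <= n) && pool w L q y).

Lemma floor_in_pool L q p x : p <= n -> is_floor (sentinel_pool L q) p x ->
  floor_in (pool w L q) p = x.
Proof.
move=> pn [xp ux max]; apply: floor_in_eq => // [x0 | z xz zp].
  by move: ux; rewrite /sentinel_pool => /orP [/eqP x00 | /andP [_ //]]; rewrite x00 in x0.
have := max z xz zp; rewrite /sentinel_pool negb_or => /andP [_].
by rewrite (leq_trans zp pn).
Qed.

Lemma find_correct L q (s : state) T :
  q < n -> s.1 11 = b -> s.1 14 = q.+1 -> s.2 4 q.+1 = prev w q.+1 ->
  (forall y, 0 < y -> y < 2 ^ b -> s.2 6 y = trunc_log 2 y) ->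
  (forall B, B <= nb -> s.2 7 B = mask b (sentinel_pool L q) B) ->
  groups nb (s.2 7) (s.2 8) (s.2 9) (s.2 10) -> 60 <= T ->
  runs W find_code s T (fun s' T' => exists blk y r,
    [/\ s' = (r, s.2), same_off [:: 15; 16; 17; 18] s.1 r,
        [/\ r 16 = blk, r 18 = y, y < b & blk <= nb],
        is_floor (sentinel_pool L q) (prev w q.+1) (blk * b + y) & T <= T' + 60]).
Proof.
move=> qn s11 s14 m4 m6 m7 grp CT; have W1 := W_gt1 n2 nW; have W0 := ltnW W1.
have b0 : 0 < b := log_gt0 n2; have bn : 2 ^ b <= n := log_le n2.
have nbn := blocks_le.
set p := prev w q.+1 in m4 *; have pq : p <= q by rewrite -ltnS prev_lt.
set B := p %/ b; have Bnb : B <= nb by apply: leq_div2r; lia.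
set r := p %% b; have rb : r < b by rewrite ltn_mod.
set X := mask b (sentinel_pool L q) B %% 2 ^ r.+1.
have Xb : X < 2 ^ b by apply: leq_ltn_trans (leq_mod _ _) (mask_lt _ _ _).
have shl : 2 * 2 ^ r <= 2 ^ b by rewrite -expnS leq_exp2l.
apply: runs_seq; apply: (@runs_set _ p); rewrite /= ?s14 ?m4 //; try (rewrite -?subnDA; lia).
apply: runs_seq; apply: (@runs_set _ B); rewrite /= ?s11 ?eval_div //; try (rewrite -?subnDA; lia).
have maskB := mask_lt b (sentinel_pool L q) B.
apply: runs_seq; apply: (@runs_set _ X); rewrite /= ?s11 ?(num_small W1) //; try (rewrite -?subnDA; lia).
  rewrite m7 // [eval_binop W OpMod p b]eval_mod; last by lia.
  rewrite eval_shl; last by rewrite -/r; lia.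
  by rewrite eval_mod -?expnS //; lia.
have finish blk Y r1 T1 : same_off [:: 15; 16; 17; 18] s.1 r1 -> r1 16 = blk -> r1 17 = Y ->
    0 < Y -> Y < 2 ^ b -> blk <= nb -> is_floor (sentinel_pool L q) p (blk * b + trunc_log 2 Y) ->
    T <= T1 + 50 -> 2 < T1 ->
  runs W (assign 18 (Cell 6 (Var 17))) (r1, s.2) T1 (fun s' T' => exists blk y r,
    [/\ s' = (r, s.2), same_off [:: 15; 16; 17; 18] s.1 r,
        [/\ r 16 = blk, r 18 = y, y < b & blk <= nb],
        is_floor (sentinel_pool L q) p (blk * b + y) & T <= T' + 60]).
  move=> off r16 r17 Y0 Yb blknb fl TT1 T1_gt.
  have yb : trunc_log 2 Y < b.
    by rewrite -(ltn_exp2l _ _ (isT : 1 < 2)); apply: leq_ltn_trans Yb; apply: trunc_logP.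
  have bn' : b < n := log_small n2.
  apply: (@runs_set _ (trunc_log 2 Y)); rewrite /= ?r17 ?m6 //; try (rewrite -?subnDA; lia).
  exists blk, (trunc_log 2 Y); eexists; split; [by [] | exact: same_off_set | by [] | by [] | ].
  by lia.
apply: runs_seq; apply: (@runs_test _ (X != 0)) => //= [| XN0 | /negbNE /eqP X0]; first by rewrite -?subnDA; lia.
  apply: runs_skip; apply: (@finish B X); rewrite /= ?lt0n //; try (rewrite -?subnDA; lia).
    by do 3![apply: same_off_set => //].
  exact: floor_same_block.
(* In block 0 the sentinel bit survives every truncation, so an empty remainder means a later
   block. *)
have B_gt0 : 0 < B.
  rewrite lt0n; apply/eqP => B0; move: X0; rewrite /X B0 mask_prefix // => /eqP.
  by rewrite bits_eq0 => /forallP /(_ ord0).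
have [|loB mkB empty] := @groups_floor _ _ _ _ _ B.-1 grp; first by rewrite -?subnDA; lia.
set C := s.2 9 (s.2 8 B.-1) in loB mkB empty *.
have Cnb : C <= nb by lia.
rewrite m7 // in mkB; have maskC := mask_lt b (sentinel_pool L q) C.
apply: runs_seq; apply: (@runs_set _ C); rewrite /= ?(num_small W1) // ?eval_sub ?subn1 //; try (rewrite -?subnDA; lia).
apply: (@runs_set _ (mask b (sentinel_pool L q) C)); rewrite /= ?m7 //; try (rewrite -?subnDA; lia).
apply: (@finish C (mask b (sentinel_pool L q) C)); rewrite /= ?lt0n //; try (rewrite -?subnDA; lia).
  by do 5![apply: same_off_set => //].
apply: floor_other_block => //; first by rewrite -/B; lia.
by move=> D CD DB; rewrite -m7 ?empty //; rewrite -/B in DB; lia.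
Qed.

Lemma match_correct d L q (s : state) T :
  q < n -> s.1 11 = b -> s.1 14 = q.+1 -> s.2 4 q.+1 = prev w q.+1 ->
  (forall y, 0 < y -> y < 2 ^ b -> s.2 6 y = trunc_log 2 y) ->
  (forall B, B <= nb -> s.2 7 B = mask b (sentinel_pool L q) B) ->
  groups nb (s.2 7) (s.2 8) (s.2 9) (s.2 10) -> trunc_log 2 nb.+1 <= d ->
  200 + 10 * potential d nb (s.2 8) (s.2 9) (s.2 10) <= T ->
  runs W match_code s T (fun s' T' =>
    [/\ same_off [:: 6; 15; 16; 17; 18; 19; 20; 21; 22; 23; 24] s.1 s'.1,
        same_mem [:: 3; 7; 8; 9; 10] s.2 s'.2,
        forall y, s'.2 3 y = if y == q.+1 then (layer w L y : nat) else s.2 3 y,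
        (forall B, B <= nb -> s'.2 7 B = mask b (sentinel_pool L q.+1) B) /\
        groups nb (s'.2 7) (s'.2 8) (s'.2 9) (s'.2 10) &
        T + 10 * potential d nb (s'.2 8) (s'.2 9) (s'.2 10) <=
        T' + 200 + 10 * potential d nb (s.2 8) (s.2 9) (s.2 10)]).
Proof.
move=> qn s11 s14 m4 m6 m7 grp dnb CT; have W1 := W_gt1 n2 nW; have W0 := ltnW W1.
have b0 : 0 < b := log_gt0 n2; have bn : 2 ^ b <= n := log_le n2.
have nbn := blocks_le; have num0 : 0 %% 2 ^ W = 0 := mod0n _.
have num1 : 1 %% 2 ^ W = 1 by rewrite (num_small W1).
apply: runs_seq; apply: runs_weaken (find_correct qn s11 s14 m4 m6 m7 grp _) _; first by rewrite -?subnDA; lia.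
move=> _ T1 [blk [y [r [-> off [r16 r18 yb blknb] fl TT1]]]].
have pn : prev w q.+1 <= n by have := prev_lt w (ltn0Sn q); lia.
have xE := floor_in_pool pn fl; set x := blk * b + y in fl xE.
have [xp ux xmax] := fl.
have bly : blk + y <= x by rewrite /x leq_add2r leq_pmulr.
have x0E : (blk + y == 0) = (x == 0) by rewrite !addn_eq0 muln_eq0 [b == 0]gtn_eqF ?orbF.
have r14 : r 14 = q.+1 by rewrite off.
have layE : layer w L q.+1 = (x != 0) by rewrite /layer /= xE.
have poolE z : sentinel_pool L q.+1 z = sentinel_pool L q z && ((z == 0) || (z != x)).
  by rewrite /sentinel_pool /= xE; case: (z == 0); rewrite //= andbA.
have xn : x <= n by lia.
have yn : b < n := log_small n2.
apply: (@runs_test _ (x != 0)); rewrite /= ?r16 ?r18 ?eval_add; try (rewrite -?subnDA; lia).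
  move=> xN0; apply: runs_seq; apply: (@runs_put _ q.+1 1); rewrite //=; first by rewrite -?subnDA; lia.
  have xdiv : x %/ b = blk by rewrite /x divnMDl // divn_small // addn0.
  have xmod : x %% b = y by rewrite /x modnMDl modn_small.
  have maskE : mask b (sentinel_pool L q) blk = mask b (sentinel_pool L q.+1) blk + 2 ^ y.
    rewrite -xdiv -xmod; apply: mask_set => // [|z zx].
      by rewrite poolE (negbTE xN0) eqxx andbF.
    by rewrite poolE zx orbT andbT.
  have maskO B : B != blk -> mask b (sentinel_pool L q.+1) B = mask b (sentinel_pool L q) B.
    move=> ne; apply: mask_eq => // z zB; rewrite poolE.
    have -> : z != x by apply: contraNneq ne => zx; rewrite -zB zx xdiv.
    by rewrite orbT andbT.
  have yb' : 2 ^ y < 2 ^ b by rewrite ltn_exp2l.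
  have maskblk := mask_lt b (sentinel_pool L q) blk.
  apply: runs_seq; apply: (@runs_put _ blk (mask b (sentinel_pool L q.+1) blk)); rewrite //= ?r16 ?r18 //; last first.
  - have m7' : forall B, B <= nb -> set_cell (set_cell s.2 3 q.+1 1) 7 blk
        (mask b (sentinel_pool L q.+1) blk) 7 B = mask b (sentinel_pool L q.+1) B.
      by move=> B Bnb /=; case: eqVneq => [-> // | ne]; rewrite maskO // m7.
    have lostE z : set_cell (set_cell s.2 3 q.+1 1) 7 blk
        (mask b (sentinel_pool L q.+1) blk) 3 z = if z == q.+1 then (layer w L z : nat) else s.2 3 z.
      by rewrite /=; case: eqP => // ->; rewrite layE xN0.
    have memE : same_mem [:: 3; 7; 8; 9; 10] s.2 (set_cell (set_cell s.2 3 q.+1 1) 7 blk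
        (mask b (sentinel_pool L q.+1) blk)) by do 2![apply: same_mem_set => //].
    have potE : potential d nb (set_cell (set_cell s.2 3 q.+1 1) 7 blk (mask b (sentinel_pool L q.+1) blk) 8)
        (set_cell (set_cell s.2 3 q.+1 1) 7 blk (mask b (sentinel_pool L q.+1) blk) 9)
        (set_cell (set_cell s.2 3 q.+1 1) 7 blk (mask b (sentinel_pool L q.+1) blk) 10) =
      potential d nb (s.2 8) (s.2 9) (s.2 10) by [].
    have mblk : s.2 7 blk != 0 by rewrite m7 // maskE -lt0n addn_gt0 expn_gt0 orbT.
    apply: (@runs_test _ (mask b (sentinel_pool L q.+1) blk != 0)); rewrite /= ?r16 ?eqxx //; first by rewrite -?subnDA; lia.
      move=> mN0; apply: runs_skip; split=> //=.
      + by move=> z zN; rewrite off //; apply: contra zN; rewrite !inE => /or4P [] ->; rewrite ?orbT.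
      + split=> //; apply: groups_eq grp => B /=; case: (eqVneq B blk) => //= ->.
        by rewrite (negbTE mblk) (negbTE mN0).
      + by rewrite potE -?subnDA; clear -CT TT1; lia.
    move=> /negbNE /eqP m0.
    (* Block 0 never becomes empty, because of the sentinel; an emptied block thus has a left
       neighbour. *)
    have blk0 : 0 < blk.
      rewrite lt0n; apply/eqP => blk0.
      have := @mask_neq0 b b0 (sentinel_pool L q.+1) 0 isT.
      by rewrite div0n -[X in mask _ _ X]blk0 m0 eqxx.
    apply: (runs_weaken (@merge_correct d blk (s.2 7) _ _ _ _ _ _ _ _ _ _ _)) => //=.
    + by rewrite eqxx.
    + by move=> B /negbTE ->.
    + by rewrite potE -?subnDA; clear -CT TT1; lia.
    move=> [r' m'] T' [/= off' mem' grp' pot']; split=> //=.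
    + move=> z zN; rewrite off' ?off //; apply: contra zN; rewrite !inE; first by case/or4P => ->; rewrite ?orbT.
      by do ![case/orP => [-> | ]; rewrite ?orbT //]; move=> ->; rewrite ?orbT.
    + by move=> B a BN; rewrite mem' ?memE //; apply: contra BN; rewrite !inE => /or3P [] ->; rewrite ?orbT.
    + by move=> z; rewrite mem' // lostE.
    + by split=> // B Bnb; rewrite mem' // m7'.
    + by rewrite potE -?subnDA in pot'; clear -CT TT1 pot'; lia.
  - by rewrite -?subnDA; clear -CT TT1; lia.
  - rewrite num1 eval_shl ?m7 //; last by clear -yb' bn nW; lia.
    by rewrite mul1n eval_sub maskE ?addnK //; clear -maskE maskblk bn nW; lia.
move=> /negbNE /eqP x0; apply: (@runs_put _ q.+1 0); rewrite //=; first by rewrite -?subnDA; lia.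
have poolE' z : sentinel_pool L q.+1 z = sentinel_pool L q z.
  by rewrite poolE x0 orbN andbT.
split=> //=.
- by move=> z zN; rewrite off //; apply: contra zN; rewrite !inE => /or4P [] ->; rewrite ?orbT.
- exact: same_mem_set.
- by move=> z; case: eqP => // ->; rewrite layE x0.
- split=> // B Bnb; rewrite m7 //; apply: mask_eq => // z _; by rewrite poolE'.
by rewrite -[potential d nb (_ 8) _ _]/(potential d nb (s.2 8) (s.2 9) (s.2 10)); lia.
Qed.

End Layer.

Definition layer_code : code := (
  fill_code 7 0;;
  mask_code;;
  group_code;;
  14 ::= Num 1;;
  while (Var 14 :< Var 1 :+ Num 1) (
    match_code;;
    14 ::= Var 14 :+ Num 1))%code.

Section LayerLoop.
Variables (W : nat) (w : seq nat).
Let n := size w.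
Hypotheses (n2 : 1 < n) (nW : n.+1 < 2 ^ W).
Let b := trunc_log 2 n.
Let nb := n %/ b.

Lemma same_off_sub xs ys f g : all (mem ys) xs -> same_off xs f g -> same_off ys f g.
Proof. by move=> /allP sub fg x xN; apply: fg; apply: contra xN => /sub. Qed.

Lemma same_mem_sub xs ys m m' : all (mem ys) xs -> same_mem xs m m' -> same_mem ys m m'.
Proof. by move=> /allP sub mm b' a bN; apply: mm; apply: contra bN => /sub. Qed.

Lemma same_mem_trans xs m1 m2 m3 : same_mem xs m1 m2 -> same_mem xs m2 m3 -> same_mem xs m1 m3.
Proof. by move=> m12 m23 b' a bN; rewrite m23 ?m12. Qed.

(** The height [b.+1] suffices for at most [n + 1 <= 2 ^ b.+1] blocks. In [(nb + 1) * (b + 1)], the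
    product [nb * b] is at most [n], and so are [nb] and [b]: merging takes linear time per pass. *)
Lemma potential_bound lab lo hi : potential b.+1 nb lab lo hi <= 3 * n + 1.
Proof.
apply: leq_trans (potential_le _ _ _ _ _) _.
have : nb * b <= n by apply: leq_trunc_div.
have := log_small n2; have := blocks_le w; rewrite mulSn mulnS -/b -/n -/nb; lia.
Qed.

Definition layer_vars := [:: 6; 14; 15; 16; 17; 18; 19; 20; 21; 22; 23; 24].
Definition layer_banks := [:: 3; 7; 8; 9; 10].

Lemma layer_correct L (s : state) T :
  s.1 1 = n -> s.1 11 = b -> (forall q, 0 < q -> q <= n -> s.2 4 q = prev w q) ->
  (forall y, 0 < y -> y < 2 ^ b -> s.2 6 y = trunc_log 2 y) ->
  (forall y, y <= n -> s.2 3 y = ((y == 0) || L y)) -> 800 * n <= T ->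
  runs W layer_code s T (fun s' T' =>
    [/\ same_off layer_vars s.1 s'.1, same_mem layer_banks s.2 s'.2,
        forall y, y <= n -> s'.2 3 y = ((y == 0) || layer w L y) & T <= T' + 800 * n]).
Proof.
move=> s1 s11 m4 m6 m3 CT; have W1 := W_gt1 n2 nW; have W0 := ltnW W1.
have b0 : 0 < b := log_gt0 n2; have nbn : nb <= n := blocks_le w.
have num1 : 1 %% 2 ^ W = 1 by rewrite (num_small W1).
apply: runs_seq; apply: (runs_weaken (@fill_correct W w n2 nW 7 0 s T _ _ _)) => //; first lia.
move=> sA TA [offA memA zeroA TTA].
apply: runs_seq; apply: (runs_weaken (@mask_correct W w n2 nW (fun y => (y == 0) || L y) sA TA _ _ _ _ _)) => //.
- by rewrite offA.
- by rewrite offA.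
- by move=> y yn; rewrite memA // m3.
- lia.
move=> sB TB [offB memB maskB TTB].
have maskE B : B <= n -> sB.2 7 B = mask b (sentinel_pool w L 0) B.
  move=> Bn; rewrite maskB //; apply: mask_eq => // y _; rewrite /sentinel_pool.
  by case: y.
apply: runs_seq; apply: (runs_weaken (@group_correct W w n2 nW sB TB _ _ _ _)) => //.
- by rewrite offB // offA.
- by rewrite offB // offA.
- rewrite maskE //; have := @mask_neq0 b b0 (sentinel_pool w L 0) 0 isT.
  by rewrite div0n.
- lia.
move=> sC TC [offC memC grpC TTC].
have offS : same_off layer_vars s.1 sC.1.
  by apply: same_off_trans (same_off_trans (same_off_sub _ offA) (same_off_sub _ offB))
    (same_off_sub _ offC).
have memS : same_mem layer_banks s.2 sC.2.
  by apply: same_mem_trans (same_mem_trans (same_mem_sub _ memA) (same_mem_sub _ memB))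
    (same_mem_sub _ memC).
have dnb : trunc_log 2 nb.+1 <= b.+1.
  rewrite -[leqRHS](@trunc_expnK 2) //; apply: leq_trunc_log.
  by rewrite expnS; have := log_lt w; rewrite -/n -/b; lia.
set pot := potential b.+1 nb.
have pot0 := potential_bound (sC.2 8) (sC.2 9) (sC.2 10).
apply: runs_seq; apply: (@runs_set _ 1); rewrite //= ?num1 //; try lia.
(* Bank 3 is overwritten in place: during the pass the old level lives on in the masks alone. Ten
   times the potential is kept in credits, so that each merge is paid for by its drop. *)
apply: (@runs_while _ _ _ _ _ _ (fun s' T' => [/\ same_off layer_vars s.1 s'.1,
    same_mem layer_banks s.2 s'.2, 0 < s'.1 14 <= n.+1,
    forall y, s'.2 3 y = if 0 < y < s'.1 14 then (layer w L y : nat) else s.2 3 y &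
    [/\ forall B, B <= nb -> s'.2 7 B = mask b (sentinel_pool w L (s'.1 14).-1) B,
      groups nb (s'.2 7) (s'.2 8) (s'.2 9) (s'.2 10),
      220 * (n.+1 - s'.1 14) + 20 + 10 * pot (s'.2 8) (s'.2 9) (s'.2 10) <= T' &
      TC + 10 * pot (s'.2 8) (s'.2 9) (s'.2 10) <=
        T' + 220 * s'.1 14 + 10 * pot (sC.2 8) (sC.2 9) (sC.2 10)]])).
  split=> //=; [exact: same_off_set | | split=> //].
  - move=> y; rewrite ifF; last by lia.
    by rewrite memC // memB // memA.
  - by move=> B Bnb; rewrite memC // maskE //; lia.
  - by rewrite /pot; lia.
  - by rewrite /pot; lia.
move=> [r m] T' [/= off mem]; set q := r 14 => /andP [q0 qn] lost [maskq grp CT' TT'].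
have r1 : r 1 = n by rewrite off.
have r11 : r 11 = b by rewrite off.
rewrite r1 num1 eval_add ?addn1 // eval_lt //.
split=> [|lt|ge]; first by lia.
  have {}lt : q <= n by lia.
  have qE : q = q.-1.+1 by lia.
  apply: runs_seq; apply: (runs_weaken (@match_correct W w n2 nW b.+1 L q.-1 (r, m) _ _ _ _ _ _ _ _ _ _)) => //=.
  - lia.
  - by rewrite -qE mem // m4.
  - by move=> y y0 yb; rewrite mem // m6.
  - by rewrite -/pot; lia.
  move=> [r' m'] T1 [/= off' mem' lost' [maskq' grp'] pot'].
  have r'14 : r' 14 = q by rewrite off'.
  rewrite -/pot in pot'.
  apply: (@runs_set _ q.+1); rewrite //= ?num1 ?r'14 ?eval_add ?addn1 //; try lia.
  split=> //=.
  - by apply: same_off_set => //; apply: same_off_trans off (same_off_sub _ off').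
  - by apply: same_mem_trans mem (same_mem_sub _ mem').
  - move=> y; rewrite lost' lost -qE ltnS; case: (eqVneq y q) => [-> | ne].
      by rewrite q0 leqnn.
    by rewrite [y <= q]leq_eqVlt (negbTE ne).
  - by split=> //; [rewrite [in sentinel_pool _ _ _]qE | lia | lia].
have iE : q = n.+1 by lia.
split=> //; last by move: pot0; rewrite -/pot; lia.
by move=> [|y] yn; rewrite lost iE ?m3 //= !ltnS yn.
Qed.

End LayerLoop.

(** * The whole program *)

Definition lost_code : code := (
  prev_code;;
  log_code;;
  log_table_code;;
  fill_code 3 1;;
  13 ::= Num 0;;
  while (Var 13 :< Var 3) (
    layer_code;;
    13 ::= Var 13 :+ Num 1))%code.

Definition count_code : code := (
  6 ::= Num 0;;
  25 ::= Num 0;;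
  while (Var 6 :< Var 1) (
    6 ::= Var 6 :+ Num 1;;
    25 ::= Var 25 :+ Cell 3 (Var 6)))%code.

(** The borrow is taken before the low word is overwritten. The result starts without digits, so
    that the final addition turns the two words into digits. *)
Definition deficit_code : code := (
  9 ::= Var 3 :+ Num 0;;
  10 ::= Var 2 :+ Num 0;;
  repeated_add;;
  25 ::= Var 1 :- Var 25;;
  26 ::= Var 4 :< Var 25;;
  4 ::= Var 4 :- Var 25;;
  5 ::= Var 5 :- Var 26;;
  0 ::= Num 0)%code.

(** The letters of the word are exactly 1 to [sigma], so [sigma] is found as their maximum. *)
Definition sigma_code : code := (
  6 ::= Num 0;;
  while (Var 6 :< Var 1) (
    7 ::= Cell 1 (Var 6);;
    ifc (Var 2 :< Var 7) (2 ::= Var 7 :+ Num 0) skip;;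
    6 ::= Var 6 :+ Num 1))%code.

Section Pieces.
Variables (W : nat) (w : seq nat).
Let n := size w.
Hypotheses (n2 : 1 < n) (nW : n.+1 < 2 ^ W).
Let b := trunc_log 2 n.

Definition lost_vars := [:: 6; 7; 11; 12; 13; 14; 15; 16; 17; 18; 19; 20; 21; 22; 23; 24].
Definition lost_banks := [:: 3; 4; 5; 6; 7; 8; 9; 10].

Lemma lost_correct k (s : state) T :
  s.1 1 = n -> s.1 3 = k -> k <= n -> {in w, forall a, a <= n} ->
  (forall i, i < n -> s.2 1 i = nth 0 w i) -> (forall a, s.2 5 a = 0) -> s.2 6 1 = 0 ->
  1000 * n * k.+1 <= T ->
  runs W lost_code s T (fun s' T' =>
    [/\ same_off lost_vars s.1 s'.1, same_mem lost_banks s.2 s'.2,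
        forall y, 0 < y -> y <= n -> s'.2 3 y = lost w k y & T <= T' + 1000 * n * k.+1]).
Proof.
move=> s1 s3 kn wn m1 m5 m61 CT; have W1 := W_gt1 n2 nW; have W0 := ltnW W1.
have num1 : 1 %% 2 ^ W = 1 by rewrite (num_small W1).
apply: runs_seq; apply: (runs_weaken (@prev_correct W w n2 nW s T _ _ _ _ _)) => //; first lia.
move=> sA TA [offA memA prevA TTA].
apply: runs_seq; apply: (runs_weaken (@log_correct W w n2 nW sA TA _ _)) => //.
- by rewrite offA.
- lia.
move=> sB TB [offB memB b11 b12 TTB].
apply: runs_seq; apply: (runs_weaken (@log_table_correct W w n2 nW sB TB _ _ _)) => //.
- by rewrite memB memA.
- lia.
move=> sC TC [offC memC tabC TTC].
apply: runs_seq; apply: (runs_weaken (@fill_correct W w n2 nW 3 1 sC TC _ _ _)) => //.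
- by rewrite offC // offB // offA.
- lia.
move=> sD TD [offD memD oneD TTD].
have offS : same_off lost_vars s.1 sD.1.
  apply: same_off_trans (same_off_sub _ offD) => //.
  by apply: same_off_trans (same_off_trans (same_off_sub _ offA) (same_off_sub _ offB))
    (same_off_sub _ offC).
have memS : same_mem lost_banks s.2 sD.2.
  apply: same_mem_trans (same_mem_sub _ memD) => //.
  apply: same_mem_trans (same_mem_sub _ memC) => //.
  by rewrite memB; apply: same_mem_sub memA.
have D11 : sD.1 11 = b by rewrite offD // offC.
have D4 q : 0 < q -> q <= n -> sD.2 4 q = prev w q.
  by move=> q0 qn; rewrite memD // memC // memB prevA.
have D6 y : 0 < y -> y < 2 ^ b -> sD.2 6 y = trunc_log 2 y.
  by move=> y0 yb; rewrite memD // tabC.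
apply: runs_seq; apply: (@runs_set _ 0); rewrite //= ?mod0n //; try lia.
apply: (@runs_while _ _ _ _ _ _ (fun s' T' => [/\ same_off (13 :: layer_vars) sD.1 s'.1,
    same_mem layer_banks sD.2 s'.2, s'.1 13 <= k,
    forall y, y <= n -> s'.2 3 y = ((y == 0) || lost w (s'.1 13) y) &
    (800 * n + 10) * (k - s'.1 13) + 10 <= T' /\
    TD <= T' + (800 * n + 10) * s'.1 13 + 10])).
  split=> //=; [exact: same_off_set | | lia].
  by move=> y yn; rewrite oneD //= orbT.
move=> [r m] T' [/= off mem]; set i := r 13 => ik lostE [CT' TT'].
have r3 : r 3 = k by rewrite off // offS.
rewrite r3 eval_lt //.
split=> [|lt|ge]; first by lia.
  have {}lt : i < k by lia.
  have CT2 : (800 * n + 10) * (k - i.+1) + (800 * n + 10) + 10 <= T'.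
    by apply: leq_trans CT'; rewrite -[k - i]subnSK // mulnS; lia.
  apply: runs_seq; apply: (runs_weaken (@layer_correct W w n2 nW (lost w i) (r, m) _ _ _ _ _ _ _)) => //=.
  - by rewrite off // offS.
  - by rewrite off.
  - by move=> q q0 qn; rewrite mem // D4.
  - by move=> y y0 yb; rewrite mem // D6.
  - lia.
  move=> [r' m'] T1 [/= off' mem' lost' TT1].
  have r'13 : r' 13 = i by rewrite off'.
  apply: (@runs_set _ i.+1); rewrite //= ?num1 ?r'13 ?eval_add ?addn1 //; try lia.
  split=> //=.
  - by apply: same_off_set => //; apply: same_off_trans off (same_off_sub _ off').
  - by apply: same_mem_trans mem mem'.
  - lia.
have iE : i = k by lia.
split=> //.
- by apply: same_off_trans offS (same_off_sub _ off).
- by apply: same_mem_trans memS (same_mem_sub _ mem).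
- by move=> y y0 yn; rewrite lostE // iE gtn_eqF.
rewrite iE in TT'; lia.
Qed.

Lemma count_correct (L : nat -> bool) (s : state) T :
  s.1 1 = n -> (forall y, 0 < y -> y <= n -> s.2 3 y = L y) -> 20 * n.+1 <= T ->
  runs W count_code s T (fun s' T' =>
    [/\ same_off [:: 6; 25] s.1 s'.1, s'.2 = s.2, s'.1 25 = cnt L 0 n & T <= T' + 20 * n.+1]).
Proof.
move=> s1 m3 CT; have W1 := W_gt1 n2 nW; have W0 := ltnW W1.
have num1 : 1 %% 2 ^ W = 1 by rewrite (num_small W1).
have cnt_le i : cnt L 0 i <= i.
  elim: i => [|i IH]; first by rewrite cnt_ge.
  by rewrite cntS //; case: (L _); rewrite ?addn1 ?addn0 ?ltnS //; apply: leqW.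
apply: runs_seq; apply: (@runs_set _ 0); rewrite //= ?mod0n //; try lia.
apply: runs_seq; apply: (@runs_set _ 0); rewrite //= ?mod0n //; try lia.
apply: (@runs_while _ _ _ _ _ _ (fun s' T' => [/\ same_off [:: 6; 25] s.1 s'.1,
    s'.2 = s.2, s'.1 6 <= n, s'.1 25 = cnt L 0 (s'.1 6) &
    20 * (n - s'.1 6) + 10 <= T' /\ T <= T' + 20 * s'.1 6 + 10])).
  split=> //=; [by do 2![apply: same_off_set => //] | by rewrite cnt_ge | lia].
move=> [r m] T' [/= off mE]; set i := r 6 => iN cE [CT' TT'].
rewrite off // s1 eval_lt //.
split=> [|lt|ge]; first by lia.
  have {}lt : i < n by lia.
  have := cnt_le i.+1 => ci.
  apply: runs_seq; apply: (@runs_set _ i.+1); rewrite //= ?num1 ?eval_add ?addn1 //; try lia.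
  have stepE : cnt L 0 i + L i.+1 = cnt L 0 i.+1 by rewrite -cntS.
  apply: (@runs_set _ (cnt L 0 i.+1)); rewrite //= ?cE ?mE ?m3 // ?eval_add ?stepE //; try lia.
  by split=> //=; [do 2![apply: same_off_set => //] | lia].
have iE : i = n by lia.
by split=> //; [rewrite cE iE | lia].
Qed.

Lemma deficit_correct k sigma (s : state) T :
  s.1 1 = n -> s.1 2 = sigma -> s.1 3 = k -> k <= n -> sigma <= n ->
  s.1 25 <= n -> n - s.1 25 <= k * sigma -> 20 * k + 100 <= T ->
  runs W deficit_code s T (fun s' T' =>
    [/\ s'.2 = s.2, s'.1 0 = 0,
        s'.1 4 + s'.1 5 * 2 ^ W = k * sigma - (n - s.1 25), s'.1 4 < 2 ^ W & (s'.1 5).+1 < 2 ^ W]).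
Proof.
move=> s1 s2 s3 kn sn; set c := s.1 25 => cn Fks CT.
have W1 := W_gt1 n2 nW; have W0 := ltnW W1.
have num0 : 0 %% 2 ^ W = 0 := mod0n _.
apply: runs_seq; apply: (@runs_set _ k); rewrite //= ?num0 ?s3 ?eval_add ?addn0 //; try (rewrite -?subnDA; lia).
apply: runs_seq; apply: (@runs_set _ sigma); rewrite //= ?num0 ?s2 ?eval_add ?addn0 //; try (rewrite -?subnDA; lia).
apply: runs_seq; apply: (runs_weaken (@repeated_add_correct W W1 k sigma (set_reg (set_reg s.1 9 k) 10 sigma, s.2) _ _ _ _ _ _)) => //=; try (rewrite -?subnDA; lia).
move=> [r m] T' [/= mE off val loB TT'].
set lo := r 4 in val loB *; set hi := r 5 in val *.
have r1 : r 1 = n by rewrite off.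
have r25 : r 25 = c by rewrite off.
(* A high word of at most [n] leaves the room for a carry that [adding] demands. *)
have hin : hi <= n.
  have : hi * 2 ^ W <= n * 2 ^ W.
    apply: (@leq_trans (k * sigma)); first by rewrite -val leq_addl.
    apply: (@leq_trans (n * n)); first exact: leq_mul.
    by rewrite leq_mul2l ltnW ?orbT //; apply: leq_trans nW.
  by rewrite leq_pmul2r // expn_gt0.
set F := n - c in Fks *; have Fn : F <= n by apply: leq_subr.
apply: runs_seq; apply: (@runs_set _ F); rewrite //= ?r1 ?r25 ?eval_sub //; try (rewrite -?subnDA; lia).
apply: runs_seq; apply: (@runs_set _ (lo < F)); rewrite //= ?eval_lt //; try (rewrite -?subnDA; lia).
have borrow : (lo + 2 ^ W - F) %% 2 ^ W + F = lo + (lo < F) * 2 ^ W.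
  have [lt | ge] := ltnP lo F.
    by rewrite modn_small; lia.
  by rewrite -addnBAC // modnDr modn_small; lia.
have c1 : (lo < F) <= 1 by case: (lo < F).
have hi0 : (lo < F) <= hi.
  case: ltnP => // lt; rewrite lt0n; apply/eqP => h0; move: val; rewrite h0; lia.
apply: runs_seq; apply: (@runs_set _ ((lo + 2 ^ W - F) %% 2 ^ W)); rewrite //=; try (rewrite -?subnDA; lia).
apply: runs_seq; apply: (@runs_set _ (hi - (lo < F))); rewrite //= ?eval_sub //; try (rewrite -?subnDA; lia).
apply: (@runs_set _ 0); rewrite //= ?num0 //; try (rewrite -?subnDA; lia).
split=> //; [ | by rewrite ltn_mod expn_gt0 | clear -hin nW; lia].
rewrite mulnBl; have : (lo < F) * 2 ^ W <= hi * 2 ^ W by rewrite leq_mul2r hi0 orbT.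
lia.
Qed.

Lemma sigma_correct sigma (s : state) T :
  s.1 1 = n -> s.1 2 = 0 -> 0 < sigma -> sigma <= n -> w =i letters sigma ->
  (forall i, i < n -> s.2 1 i = nth 0 w i) -> 20 * n.+1 <= T ->
  runs W sigma_code s T (fun s' T' =>
    [/\ same_off [:: 2; 6; 7] s.1 s'.1, s'.2 = s.2, s'.1 2 = sigma & T <= T' + 20 * n.+1]).
Proof.
move=> s1 s2 sigma0 sigman wS m1 CT; have W1 := W_gt1 n2 nW; have W0 := ltnW W1.
have num0 : 0 %% 2 ^ W = 0 := mod0n _.
have num1 : 1 %% 2 ^ W = 1 by rewrite (num_small W1).
apply: runs_seq; apply: (@runs_set _ 0); rewrite //= ?mod0n //; try lia.
apply: (@runs_while _ _ _ _ _ _ (fun s' T' => [/\ same_off [:: 2; 6; 7] s.1 s'.1,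
    s'.2 = s.2, s'.1 6 <= n,
    s'.1 2 <= sigma /\ (forall j, j < s'.1 6 -> nth 0 w j <= s'.1 2) &
    20 * (n - s'.1 6) + 10 <= T' /\ T <= T' + 20 * s'.1 6 + 10])).
  by split=> //=; [apply: same_off_set | rewrite s2 | lia].
move=> [r m] T' [/= off mE]; set i := r 6 => iN [le max] [CT' TT'].
have r1 : r 1 = n by rewrite off.
rewrite r1 eval_lt //.
split=> [|lt|ge]; first by lia.
  have {}lt : i < n by lia.
  set a := nth 0 w i.
  have mi : m 1 i = a by rewrite mE m1.
  have aS : a <= sigma.
    by have : a \in w by [apply: mem_nth]; rewrite wS inE /= => /andP [].
  apply: runs_seq; apply: (@runs_set _ a); rewrite //=; try lia.
  apply: runs_seq; apply: (@runs_weaken _ _ _ _ (fun s1 T1 => exists2 r1,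
    s1 = (r1, m) & [/\ same_off [:: 2; 6; 7] s.1 r1, r1 2 = maxn (r 2) a, r1 6 = i & T' <= T1 + 12])).
    apply: (@runs_test _ (r 2 < a)) => /= [|| lt' | ge'].
    + by rewrite eval_lt //; case: (_ < _).
    + lia.
    + apply: (@runs_set _ a); rewrite /= ?num0 ?eval_add ?addn0 //; try lia.
      eexists; first by []; split=> //=; [by do 2![apply: same_off_set => //] | lia | lia].
    + apply: runs_skip; eexists; first by [].
      split=> //=; [exact: same_off_set | lia | lia].
  move=> _ T1 [r1' -> [off1 r2 r6 TT1]].
  apply: (@runs_set _ i.+1); rewrite /= ?r6 ?num1 ?eval_add ?addn1 //; try lia.
  split=> //=; [exact: same_off_set | | lia].
  rewrite r2; split; first by rewrite geq_max le.
  move=> j; rewrite ltnS leq_eqVlt => /predU1P [-> | ji]; first exact: leq_maxr.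
  by apply: leq_trans (max j ji) (leq_maxl _ _).
have iE : i = n by lia.
split=> //; last by lia.
apply/eqP; rewrite eqn_leq le.
have sw : sigma \in w by rewrite wS inE /= sigma0 leqnn.
by rewrite -[X in X <= _](nth_index 0 sw) max // iE index_mem.
Qed.

End Pieces.

Definition small_code : code := (lost_code;; count_code;; deficit_code)%code.

Definition large_code (P : program) : code := (
  9 ::= Var 1 :+ Num 0;;
  10 ::= Var 2 :- Num 1;;
  repeated_add;;
  30 ::= Var 0 :+ Num 0;;
  31 ::= Var 1 :+ Num 0;;
  32 ::= Var 2 :+ Num 0;;
  call P;;
  0 ::= Var 30 :+ Num 0)%code.

(** A digit of [k] is read only if it is the only one; a longer [k] exceeds [n], which fits a word.
    In that case the first factor of the test for [k <= n] is 0. *)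
Definition main_code (P : program) : code := (
  sigma_code;;
  ifc (Bin OpEq (Var 0) (Num 1)) (3 ::= Cell 0 (Num 0)) skip;;
  ifc (Bin OpMul (Bin OpEq (Var 0) (Num 1)) (Var 3 :< Var 1 :+ Num 1))
    small_code (large_code P);;
  add_code)%code.

(* The first instruction moves the length of the word from register 1, which is
   a temporary, to variable 1. *)
Definition main_program (P : program) : program :=
  Binop OpOr 2 1 1 :: main_code P 1.

(** * Room in a word for sizes and digit counts *)

Section WordSize.
Variables (n sigma k : nat).
Hypotheses (k0 : 0 < k) (sigma_n : sigma <= n).

(** The bits of [k] count towards the input size, and a positive [k] has at least one; this leaves
    room for [n + 1]. *)
Lemma word_size_gt : n.+1 < 2 ^ word_size n k.
Proof.
apply: leq_trans (lt_expn_ndigits (n + ndigits 2 k) (isT : 1 < 2)).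
by rewrite ltnS -addn1 leq_add2l ndigits_gt.
Qed.

(** As [sigma <= n < 2 ^ n], such a [v] has at most [n + ndigits 2 k] bits and no more digits than
    that, and the word size is chosen so that this input size is itself a word. All digits of the
    result are thus addressable. *)
Lemma ndigits_word v : v <= k * sigma -> 
  ndigits (2 ^ word_size n k) v < 2 ^ word_size n k.
Proof.
move=> vk; have nW := word_size_gt; have B1 : 1 < 2 ^ word_size n k by lia.
apply: leq_ltn_trans (lt_expn_ndigits (n + ndigits 2 k) (isT : 1 < 2)).
apply: ndigits_le => //; apply: leq_ltn_trans vk _.
apply: (@leq_trans (2 ^ (n + ndigits 2 k))); last by rewrite leq_exp2r // addn_gt0 ndigits_gt // k0 orbT.
have kk := lt_expn_ndigits k (isT : 1 < 2); have nn := ltn_expl n (isT : 1 < 2).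
rewrite expnD mulnC; apply: leq_ltn_trans (leq_mul (leqnn _) (ltnW kk)) _.
by rewrite ltn_pmul2r ?expn_gt0 //; apply: leq_ltn_trans nn.
Qed.

End WordSize.

Section Main.
Variables (w : seq nat) (sigma k : nat).
Let n := size w.
Hypotheses (wS : w =i letters sigma) (sigma1 : 1 < sigma) (sigma_n : sigma <= n) (k0 : 0 < k).
Let W := word_size n k.
Let B := 2 ^ W.

Lemma size_gt1 : 1 < n.
Proof. exact: leq_trans sigma_n. Qed.

Lemma small_correct (s : state) T :
  s.1 1 = n -> s.1 2 = sigma -> s.1 3 = k -> k <= n ->
  (forall i, i < n -> s.2 1 i = nth 0 w i) ->
  (forall b a, 1 < b -> s.2 b a = 0) -> 3000 * (n * k) <= T ->
  runs W small_code s T (fun s' T' =>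
    [/\ adding B (k * sigma - best w k n) (s'.2 2) (s'.1 0) 0 (s'.1 4) (s'.1 5)
      & add_work (s'.2 2) (s'.1 0) 0 (s'.1 4) (s'.1 5) <= 3]).
Proof.
move=> s1 s2 s3 kn m1 m0 CT.
have n2 := size_gt1; have nW : n.+1 < 2 ^ W := word_size_gt n k0.
have CT' : 1000 * n * k.+1 + 20 * n.+1 + 20 * k + 100 <= T.
  have : n <= n * k by apply: leq_pmulr.
  have : k <= n * k by apply: leq_pmull; apply: ltnW.
  by rewrite -mulnA mulnS; lia.
have wn : {in w, forall a, a <= n}.
  by move=> a; rewrite wS inE /= => /andP [_ /leq_trans]; apply.
apply: runs_seq; apply: (runs_weaken (@lost_correct W w n2 nW k s T _ _ _ _ _ _ _ _)) => //.
- by move=> a; apply: m0.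
- exact: m0.
- by rewrite -/n; lia.
move=> sA TA [offA memA lostA TTA].
apply: runs_seq; apply: (runs_weaken (@count_correct W w n2 nW (lost w k) sA TA _ _ _)) => //.
- by rewrite offA.
- lia.
move=> sB TB [offB memB cB TTB].
have wS' : {subset w <= letters sigma} by move=> a; rewrite wS.
have bestE := best_lost k (leqnn (size w)); rewrite -/n in bestE.
have bestF : n - sB.1 25 = best w k n by rewrite cB -/n; lia.
apply: (runs_weaken (@deficit_correct W w n2 nW k sigma sB TB _ _ _ _ _ _ _ _)) => //.
- by rewrite offB // offA.
- by rewrite offB // offA.
- by rewrite offB // offA.
- by rewrite cB -/n; lia.
- by rewrite bestF; apply: best_le.
- lia.
move=> [r m] T' [/= mE r0 val loB hiB].
rewrite r0; split; last by rewrite /add_work big_geq //; case: (r 4); case: (r 5).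
by split; rewrite // /digit_sum big_ord0 expn0 muln1 val bestF.
Qed.

Lemma large_correct P (T : nat -> nat -> nat -> nat) (s : state) T0 :
  s.1 0 = ndigits B k -> s.1 1 = n -> s.1 2 = sigma -> (forall x, 29 < x -> s.1 x = 0) ->
  n < k -> s.2 = (fun b a => nth 0 (nth [::] [:: digits B k; w] b) a) ->
  computes_product_in P T -> 100 * n + T n sigma k + 100 <= T0 ->
  runs W (large_code P) s T0 (fun s' T' =>
    [/\ adding B (k * sigma - n) (s'.2 2) (s'.1 0) 0 (s'.1 4) (s'.1 5),
      add_work (s'.2 2) (s'.1 0) 0 (s'.1 4) (s'.1 5) <= T n sigma k + 3 &
      T0 <= T' + T n sigma k + 50 * n + 100]).
Proof.
move=> s0 s1 s2 s30 nk mE PT CT.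
have n2 := size_gt1; have nW : n.+1 < 2 ^ W := word_size_gt n k0.
have W1 := W_gt1 n2 nW; have W0 := ltnW W1.
have num0 : 0 %% 2 ^ W = 0 := mod0n _.
have num1 : 1 %% 2 ^ W = 1 by rewrite (num_small W1).
have ndk : ndigits B k < B.
  by apply: (ndigits_word k0 sigma_n); rewrite leq_pmulr // ltnW.
apply: runs_seq; apply: (@runs_set _ n); rewrite //= ?num0 ?s1 ?eval_add ?addn0 //; try lia.
apply: runs_seq; apply: (@runs_set _ sigma.-1); rewrite //= ?num1 ?s2 ?eval_sub ?subn1 //; try lia.
apply: runs_seq; apply: (runs_weaken (@repeated_add_correct W W1 n sigma.-1 (set_reg (set_reg s.1 9 n) 10 sigma.-1, s.2) _ _ _ _ _ _)) => //=; try lia.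
move=> [r m] T1 [/= mE' off val loB TT1]; rewrite {}mE' {m}.
set lo := r 4 in val loB *; set hi := r 5 in val *.
have r0 : r 0 = ndigits B k by rewrite off.
have r1 : r 1 = n by rewrite off.
have r2 : r 2 = sigma by rewrite off.
have hin : hi < n.
  have B0 : 0 < B by rewrite expn_gt0.
  rewrite -(ltn_pmul2r B0); apply: (@leq_ltn_trans (n * sigma.-1)); first by rewrite -val leq_addl.
  by rewrite ltn_pmul2l; rewrite /B; lia.
apply: runs_seq; apply: (@runs_set _ (ndigits B k)); rewrite //= ?num0 ?r0 ?eval_add ?addn0 //; try lia.
apply: runs_seq; apply: (@runs_set _ n); rewrite //= ?num0 ?r1 ?eval_add ?addn0 //; try lia.
apply: runs_seq; apply: (@runs_set _ sigma); rewrite //= ?num0 ?r2 ?eval_add ?addn0 //; try lia.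
have [hal [nd dig]] := PT n sigma k sigma1 sigma_n nk; rewrite -/W -/B in hal nd dig.
set c0 := init _ _ in hal nd dig; set c := iter _ _ c0 in hal nd dig.
(* The subroutine starts on a clean machine: variables from 33 on and all banks but 0 and 1 are
   still zero, and [sub_bank] avoids bank 1. *)
have sim : simulates (fun x => set_reg (set_reg (set_reg r 30 (ndigits B k)) 31 n) 32 sigma x./2)
    s.2 c0.
  split=> [x | bk a].
    rewrite doubleK /sub_var /c0 /=; case: x => [|[|[|x]]] //=.
    rewrite nth_default //; do 3![case: eqP => [|_]; first by lia].
    rewrite off; last by rewrite !inE; lia.
    by rewrite /=; do 2![case: eqP => [|_]; first by lia]; apply: s30; lia.
  rewrite mE; case: bk => // bk.
  have -> : nth [::] [:: digits B k; w] (sub_bank bk.+1) = [::].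
    by rewrite nth_default // /sub_bank; case: ifP => //=; case: (bk) => //=; lia.
  by rewrite /c0 /= !nth_nil.
apply: runs_seq; apply: (runs_weaken (@runs_call W P (_, s.2) _ c0 (T n sigma k) sim erefl hal _)) => //=; first lia.
move=> [r' m'] T2 [[/= simr simb] old TT2].
have r'30 : r' 30 = ndigits B ((k - n) * sigma).
  by rewrite -nd -(simr 0).
have vk : (k - n) * sigma <= k * sigma by rewrite leq_mul2r leq_subr orbT.
have nd_lt : ndigits B ((k - n) * sigma) < B by apply: (ndigits_word k0 sigma_n).
apply: (@runs_set _ (ndigits B ((k - n) * sigma))); rewrite //= ?num0 ?r'30 ?eval_add ?addn0 //; try lia.
have B1 : 1 < B by rewrite /B; lia.
have cellE j : j < ndigits B ((k - n) * sigma) -> m' 2 j = nth 0 (digits B ((k - n) * sigma)) j.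
  by move=> jm; rewrite (simb 2) dig.
have r'4 : r' 4 = lo by rewrite old.
have r'5 : r' 5 = hi by rewrite old.
rewrite r'4 r'5; split.
- split=> //.
  + rewrite (digit_sum_eq B cellE) digit_sum_digits // expn0 muln1 val.
    have : n * sigma.-1 + n = n * sigma by rewrite -mulnSr prednK // ltnW.
    have : n * sigma <= k * sigma by rewrite leq_mul2r (ltnW nk) orbT.
    by rewrite mulnBl; lia.
  + by move=> j jm; rewrite cellE // digit_lt // ltnW.
  + by move=> m_gt0; rewrite cellE ?prednK // (negbTE (top_digit B1 m_gt0)).
  + by split=> //; rewrite /B; lia.
- rewrite /add_work; have [|sup szs supE] := @cell_support W P c0 (T n sigma k) 2.
    by move=> a; rewrite /c0 /= nth_nil.
  have supE' a : m' 2 a != 0 -> a \in sup by rewrite (simb 2); apply: supE.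
  have := @count_support (m' 2) 0 (ndigits B ((k - n) * sigma)) sup supE'.
  by case: (lo != 0); case: (hi != 0) => /=; lia.
by lia.
Qed.
End Main.

(** Credits set aside before a piece of code remain after it. This saves credits for the final
    addition where, as in [small_correct], the postcondition does not mention them. *)
Lemma runs_reserve W c s T d Q : d <= T -> runs W c s (T - d) Q ->
  runs W c s T (fun s' T' => d <= T' /\ Q s' (T' - d)).
Proof.
move=> dT run A o f pl ag; have [t [f' [s' [T' [le ag' q E]]]]] := run A o f pl ag.
exists t, f', s', (T' + d); split=> //; first lia.
by rewrite leq_addl addnK.
Qed.

Lemma ndigits_eq1 B v : 1 < B -> 0 < v -> (ndigits B v == 1) = (v < B).
Proof.
move=> B1 v0; have nd0 : 0 < ndigits B v by rewrite ndigits_gt.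
by rewrite eqn_leq nd0 andbT leqNgt ndigits_gt // expn1 -ltnNge.
Qed.

Section Main.
Variables (w : seq nat) (sigma k : nat).
Let n := size w.
Hypotheses (wS : w =i letters sigma) (sigma1 : 1 < sigma) (sigma_n : sigma <= n) (k0 : 0 < k).
Let W := word_size n k.
Let B := 2 ^ W.

Lemma main_correct P (T : nat -> nat -> nat -> nat) (s : state) T0 :
  s.1 0 = ndigits B k -> s.1 1 = n -> (forall x, 1 < x -> s.1 x = 0) ->
  s.2 = (fun b a => nth 0 (nth [::] [:: digits B k; w] b) a) ->
  [\/ k <= n /\ 4000 * (n * k) <= T0 |
    [/\ n < k, computes_product_in P T & 1000 * n + 40 * T n sigma k <= T0]] ->
  runs W (main_code P) s T0 (fun s' _ =>
    adding B (k * sigma - best w k n) (s'.2 2) (s'.1 0) (s'.1 6) 0 0).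
Proof.
move=> s0 s1 s_0 mE budget.
have n2 : 1 < n := leq_trans sigma1 sigma_n; have nW : n.+1 < 2 ^ W := word_size_gt n k0.
have W1 := W_gt1 n2 nW; have W0 := ltnW W1.
have num0 : 0 %% 2 ^ W = 0 := mod0n _.
have num1 : 1 %% 2 ^ W = 1 by rewrite (num_small W1).
have B1 : 1 < B by rewrite /B; lia.
have nnk : n <= n * k by apply: leq_pmulr.
have T0n : 200 * n <= T0 by case: budget => [[_ CT]|[_ _ CT]]; lia.
have sigma0 : 0 < sigma by apply: ltnW.
have m1 i : i < n -> s.2 1 i = nth 0 w i by rewrite mE.
apply: runs_seq; apply: (runs_weaken (@sigma_correct W w n2 nW sigma s T0 _ _ _ _ _ _ _)) => //; rewrite -/n ?s_0 //.
  by lia.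
move=> [r m] T1 [/= off mE' r2 TT1]; rewrite {}mE' {m}.
have r0 : r 0 = ndigits B k by rewrite off.
have r1 : r 1 = n by rewrite off.
have d0 : s.2 0 0 = k %% B.
  rewrite mE /= nth_digits ?expn0 ?divn1 //; first by rewrite ndigits_gt.
apply: runs_seq; apply: (@runs_weaken _ _ _ _ (fun s1 T2 => exists2 r1,
    s1 = (r1, s.2) & [/\ same_off [:: 3] r r1, r1 3 = (if k < B then k else 0) & T1 <= T2 + 10])).
  apply: (@runs_test _ (k < B)) => /= [|| lt | /negbTE ->].
  - by rewrite num1 r0 eval_eq // ndigits_eq1 //; case: (k < B).
  - lia.
  - apply: (@runs_set _ k); rewrite /= ?num0 ?d0 ?modn_small //; try lia.
    by eexists; [by [] | rewrite lt; split=> //=; [apply: same_off_set | lia]].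
  - apply: runs_skip; eexists; first by [].
    by split=> //; [rewrite off // s_0 | lia].
move=> _ T2 [r' -> [off' r'3 TT2]].
have r'0 : r' 0 = ndigits B k by rewrite off'.
have r'1 : r' 1 = n by rewrite off'.
have r'2 : r' 2 = sigma by rewrite off'.
have r'30 x : 29 < x -> r' x = 0.
  by move=> x29; rewrite off' ?off ?s_0 ?inE //; lia.
have vk : ndigits B (k * sigma - best w k n) < B.
  by apply: (ndigits_word k0 sigma_n); apply: leq_subr.
have finish s3 T3 C : adding B (k * sigma - best w k n) (s3.2 2) (s3.1 0) 0 (s3.1 4) (s3.1 5) ->
    add_work (s3.2 2) (s3.1 0) 0 (s3.1 4) (s3.1 5) <= C -> 30 * C + 30 <= T3 ->
    runs W add_code s3 T3 (fun s' _ =>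
      adding B (k * sigma - best w k n) (s'.2 2) (s'.1 0) (s'.1 6) 0 0).
  by move=> add work CT; apply: add_code_correct => //; lia.
have testE : (eval_binop W OpMul (eval_binop W OpEq (r' 0) (1 %% 2 ^ W))
    (eval_binop W OpLt (r' 3) (eval_binop W OpAdd (r' 1) (1 %% 2 ^ W))) != 0) = (k <= n).
  rewrite num1 r'0 r'1 r'3 eval_eq // eval_add ?addn1 // eval_lt // ndigits_eq1 //.
  have [lt | ge] := ltnP k B; last by rewrite eval_mul ?mul0n //; lia.
  by rewrite ltnS eval_mul mul1n; case: (k <= n) => //; lia.
apply: runs_seq; apply: (@runs_test _ (k <= n)) => //=; first lia.
- move=> kn; have {}budget : 4000 * (n * k) <= T0 by case: budget => [[]|[]] //; lia.
  have kB : k < B by rewrite /B; lia.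
  apply: (runs_weaken (@runs_reserve W _ (r', s.2) _ 120 _ _ (@small_correct w sigma k wS sigma1 sigma_n k0 (r', s.2) _ _ _ _ _ _ _ _))) => //=.
  + lia.
  + by rewrite r'3 kB.
  + by move=> b a b1; rewrite mE nth_default // ?nth_nil //; case: b b1 => [|[|b]] //=; rewrite nth_nil.
  + have : 2 <= n * k by apply: leq_trans nnk. lia.
  by move=> s3 T3 [CT3 [add work]]; apply: (finish _ _ 3).
rewrite -ltnNge => nk.
have [PT CT] : computes_product_in P T /\ 1000 * n + 40 * T n sigma k <= T0.
  by case: budget => [[]|[]] //; lia.
have bestE : best w k n = n by apply: best_small => //; apply: ltnW.
apply: (runs_weaken (@large_correct w sigma k sigma1 sigma_n k0 P T (r', s.2) _ _ _ _ _ _ _ _ _)) => //=.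
  rewrite -/n; lia.
move=> s3 T3 [add work TT3]; apply: (finish _ _ (T n sigma k + 3)) => //.
  by rewrite bestE.
rewrite -/n in TT3; lia.
Qed.

Lemma main_program_correct P (T : nat -> nat -> nat -> nat) T0 :
  [\/ k <= n /\ 4000 * (n * k) < T0 |
    [/\ n < k, computes_product_in P T & 1000 * n + 40 * T n sigma k < T0]] ->
  computes_from_word (main_program P) w k T0 (k * sigma - best w k n).
Proof.
move=> budget; rewrite /computes_from_word -/n -/W -/B /computes_within.
have n2 : 1 < n := leq_trans sigma1 sigma_n; have nW : n.+1 < 2 ^ W := word_size_gt n k0.
have W1 := W_gt1 n2 nW; have W0 := ltnW W1.
have T0_gt : 0 < T0 by case: budget => [[_]|[_ _]]; lia.
set A := main_program P; set c0 := init _ _.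
set f := set_reg (nth 0 [:: ndigits B k; n]) 2 n.
pose s : state := (fun x => f x.*2, cell c0).
have ag : agree s f by [].
have pl : placed A 1 (main_code P 1) by [].
have step1 : iter 1 (step W A) c0 = Config 1 f s.2.
  rewrite /= /step /= /eval_binop PeanoNat.Nat.lor_diag modn_small //; exact: ltnW.
have [||||| t [f' [s' [T' [tT ag' add E]]]]] := @main_correct P T s T0.-1 _ _ _ _ _ A 1 f pl ag => //.
- by move=> [|[|x]] //= _; rewrite /f /= nth_default.
- by case: budget => [[kn CT]|[nk PT CT]]; [left | right]; split=> //; lia.
set cf := Config _ f' _ in E.
have halt : halted A cf by apply: leqnn.
(* The program may halt early; the halted configuration stays put for the rest of the [T0] steps. *)
have -> : iter T0 (step W A) c0 = cf.
  have -> : T0 = (T0 - (1 + t)) + (1 + t) by lia.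
  by rewrite iterD (iter_cat step1 E) step_halted.
split; first exact: halt.
have [sum _ fB top _] := add.
rewrite !mul0n addn0 in sum; rewrite -sum.
have r0 : reg cf 0 = s'.1 0 by rewrite /= (ag' 0).
have cellE : cell cf 2 = s'.2 2 by [].
rewrite -r0 -cellE; apply: returns_digit_sum; rewrite ?r0 ?cellE; [exact: W0 | exact: fB |].
by move=> m0; apply/negP => /(top m0) [].
Qed.

End Main.

Theorem theorem3 (T : nat -> nat -> nat -> nat) (P : program) :
  exists (A : program) (C : nat),
  forall (w : seq nat) (n sigma k iota_w : nat),
    size w = n -> w =i letters sigma -> 1 < sigma -> sigma <= n ->
    is_universality_index w iota_w -> iota_w <= k ->
    exists d : nat,
      [/\ min_insertions (letters sigma) k w d,
          k <= n -> computes_from_word A w k (C * (n * k)) d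
        & n < k -> computes_product_in P T ->
          computes_from_word A w k (C * (n ^ 2 + T n sigma k)) d].
Proof.
(* The constant exceeds the budgets 4000, 1000 and 40 strictly, which pays for the first
   instruction. *)
exists (main_program P), 5000 => w n sigma k i <- wS sigma1 sigma_n [_ max] ik.
(* Each letter of the word is a subsequence of it, so the universality index is at least 1. *)
have k0 : 0 < k.
  apply: leq_trans ik; apply: max => -[|a []] //= _ aw.
  by rewrite sub1seq; apply: aw; apply: mem_head.
have n0 : 0 < size w by apply: leq_trans sigma_n; apply: ltnW.
exists (k * sigma - best w k (size w)); split.
- by apply: min_insertions_best; [apply: ltnW | move=> a; rewrite wS].
- move=> kn; apply: (@main_program_correct w sigma k wS sigma1 sigma_n k0 P T).
  by left; split=> //; rewrite ltn_pmul2r // muln_gt0 n0.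
- move=> nk PT; apply: (@main_program_correct w sigma k wS sigma1 sigma_n k0 P T).
  right; split=> //; have : size w <= size w ^ 2 by rewrite -mulnn leq_pmulr.
  lia.
Qed.
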